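(* Consider a sequence of problems indexed by the sample size $n\to\infty$ (with $d$, $s$, $G_*$ and $\theta>0$ allowed to depend on $n$), with $s=o(\sqrt d)$. Let $G_*$ be a (non-empty) graph on $\overline V=\{1,\dots,d\}$ with $s$ non-isolated vertices, and let $\mathcal G_1(G_* )$ be the class of all graphs on $\overline V$ that contain a subgraph isomorphic to $G_*$. Let $\mathcal B(G_* )=512\{\|A_{G_*}\|_F^4\wedge[(\|A_{G_*}\|_1\vee\|A_{G_*}\|_F)^2 s]\}$. If $$\theta\le\sqrt{\frac{\log(d/s^2)}{6n\mathcal R(G_* )}}\ \wedge\ \sqrt{\frac{\mathcal R(G_* )}{\mathcal B(G_* )}}\ \wedge\ \frac{1}{8(\|A_{G_*}\|_F\vee\|A_{G_*}\|_1)},$$ then $$\liminf_{n\to\infty}\gamma\{\mathcal S[\mathcal G_1(G_* ),\theta]\}=1.$$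
   Context: Graphs are simple undirected graphs on $\overline V=\{1,\dots,d\}$; $E(G)$ is the edge set and $A_G$ the adjacency matrix. A subgraph of $G=(\overline V,E)$ is a graph $(\overline V,E')$ with $E'\subseteq E$. $\|A\|_F$ is the Frobenius norm and $\|A\|_1$ the $\ell_1\to\ell_1$ operator norm (maximum absolute column sum). $a\wedge b=\min$, $a\vee b=\max$. Arboricity: $\mathcal R(G)=\big\lceil\max_{V\subseteq\overline V}\frac{|E(G_V)|}{|V|-1}\big\rceil$, where $G_V$ is obtained from $G$ by removing all edges having an endpoint outside $V$, and $0/0:=0$. Zero-field ferromagnetic Ising model: for a symmetric $\Theta=(\theta_{ij})\in\mathbb R^{d\times d}$ with zero diagonal and nonnegative entries, $\mathbb P_\Theta(X)=\frac1{Z_\Theta}\exp\big(\sum_{i,j=1}^d\theta_{ij}X_iX_j\big)$ on $\{\pm1\}^d$, where $Z_\Theta$ is the normalizing constant (the sum runs over all ordered pairs $(i,j)$). $G(\Theta)$ is the graph with edges $\{(i,j):\theta_{ij}\ne0\}$. $\mathbb P_{\Theta,n}$ is the joint law of $n$ i.i.d. samples; $\mathbb P_{0,n}$ is the case $\Theta=0$. For a class of graphs $\mathcal G_1$ and $\theta>0$: $\mathcal S(\mathcal G_1,\theta)=\{\Theta:\Theta=\Theta^T,\ \Theta\text{ has zero diagonal},\ G(\Theta)\in\mathcal G_1,\ \|\Theta\|_F\le1/2,\ \min_{(i,j)\in E[G(\Theta)]}\theta_{ij}\ge\theta\}$. Minimax risk: $\gamma[\mathcal S]=\inf_\psi\big[\mathbb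 P_{0,n}(\psi=1)+\max_{\Theta\in\mathcal S}\mathbb P_{\Theta,n}(\psi=0)\big]$, the infimum being over all $\{0,1\}$-valued measurable functions $\psi$ of the $n$ samples. *)

(* Defs.v *)
From mathcomp Require Import all_boot all_order all_algebra all_fingroup.
From mathcomp Require Import all_classical all_reals all_analysis.

Set Implicit Arguments.
Unset Strict Implicit.
Unset Printing Implicit Defensive.

Import Order.TTheory GRing.Theory Num.Theory.
Import numFieldNormedType.Exports.

Local Open Scope classical_set_scope.
Local Open Scope ring_scope.

Section Graphs.
Variable d : nat.
Implicit Types G H : rel 'I_d.

Definition simple_graph G : Prop := symmetric G /\ irreflexive G.

(* Each unordered edge {i, j} is represented once, by the pair with i < j. *)
Definition edges G : {set 'I_d * 'I_d} :=
  [set e : 'I_d * 'I_d | (e.1 < e.2)%N && G e.1 e.2]%SET.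

Definition nonempty_graph G : Prop := exists i j, G i j.

(* All graphs share the vertex set 'I_d, so a subgraph only drops edges and an
   isomorphism is a permutation of 'I_d. *)
Definition subgraph H G : Prop := simple_graph H /\ subrel H G.

Definition isomorphic H G : Prop :=
  exists p : {perm 'I_d}, forall i j, H (p i) (p j) = G i j.

Definition non_isolated G : {set 'I_d} := [set i | [exists j, G i j]]%SET.

Definition restrict_graph G (V : {set 'I_d}) : rel 'I_d :=
  fun i j => [&& G i j, i \in V & j \in V].

Definition containing (Gs : rel 'I_d) : set (rel 'I_d) :=
  [set G | simple_graph G /\ exists H, subgraph H G /\ isomorphic H Gs].

End Graphs.

Section Norms.
Variables (R : realType) (d : nat).
Implicit Types (A Theta : 'M[R]_d) (G : rel 'I_d).

Definition adjacency G : 'M[R]_d := \matrix_(i, j) (G i j)%:R.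

Definition frobenius_norm A : R := Num.sqrt (\sum_i \sum_j A i j ^+ 2).

(* The l1 -> l1 operator norm for matrices acting on column vectors. *)
Definition op_norm1 A : R := \big[Num.max/0]_j \sum_i `|A i j|.

(* The quotient is 0 when #|V| <= 1, since then there are no edges. *)
Definition arboricity G : int :=
  Num.ceil (\big[Num.max/0]_(V : {set 'I_d})
    (#|edges (restrict_graph G V)|%:R / (#|V|%:R - 1)) : R).

Definition calB G : R :=
  let F := frobenius_norm (adjacency G) in
  let N := op_norm1 (adjacency G) in
  512 * Num.min (F ^+ 4) (Num.max N F ^+ 2 * #|non_isolated G|%:R).

Definition support_graph Theta : rel 'I_d := fun i j => Theta i j != 0.

Definition signal_class (G1 : set (rel 'I_d)) (theta : R) : set 'M[R]_d :=
  [set Theta | [/\ Theta^T = Theta, forall i, Theta i i = 0,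
     G1 (support_graph Theta), frobenius_norm Theta <= 1 / 2
     & forall i j, support_graph Theta i j -> theta <= Theta i j]].

End Norms.

Section Ising.
Variables (R : realType) (d : nat).
Implicit Types Theta : 'M[R]_d.

(* Elements of {-1, 1}^d are encoded by booleans: true is -1, false is 1. *)
Definition config : finType := {ffun 'I_d -> bool}.
Definition spin (x : config) (i : 'I_d) : R := (-1) ^+ x i.

Definition ising_weight Theta (x : config) : R :=
  expR (\sum_i \sum_j Theta i j * spin x i * spin x j).

Definition partition_function Theta : R := \sum_x ising_weight Theta x.

Definition ising_pmf Theta (x : config) : R :=
  ising_weight Theta x / partition_function Theta.

Variable n : nat.

Definition sample : finType := {ffun 'I_n -> config}.

Definition ising_prob Theta (A : pred sample) : R :=
  \sum_(X : sample | A X) \prod_(k < n) ising_pmf Theta (X k).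

(* Every function on the finite sample space is measurable; the value true of
   psi stands for 1. *)
Definition test_risk (S : set 'M[R]_d) (psi : sample -> bool) : R :=
  ising_prob 0 psi + sup [set ising_prob Theta (predC psi) | Theta in S].

Definition minimax_risk (S : set 'M[R]_d) : R :=
  inf [set test_risk S psi | psi in [set: sample -> bool]].

End Ising.

(* Main.v *)
Require Import Defs.
From mathcomp Require Import all_boot all_order all_algebra all_fingroup.
From mathcomp Require Import all_classical all_reals all_analysis.
From mathcomp Require Import lra.

(* The null is compared with the uniform mixture, over all vertex permutations
   [p], of the models with edge weight [theta] on [p G].  By Parseval, the
   second moment of the likelihood ratio of two components is
   [sum_S m(S) m'(S)], where [m(S)] is the correlation of the spins in [S]; only
   [S] contained in the overlap [U] of the two sets of non-isolated vertices
   contribute, so it suffices to bound [sum_(S <= U) m(S)^2] for one model.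

   Simon's inequality gives [m(i + T) <= sum_j K i j m(j + T)] (symmetric
   differences, [K = 2 Theta], [i] outside [T]), and solving this recursion by
   the maximum principle gives [m(i + T) <= sum_(j in T) W i j m(T - j)] with
   [W = K (1 - K)^-1].  A raising-operator estimate turns this Wick-type bound
   into [sum_(S <= U) m(S)^2 <= exp(9/16 sum_(i, j in U) W i j ^ 2)].  The first
   order part of [W] is controlled by the arboricity, the rest by [calB], so the
   exponent is at most [11/2 theta^2 R(G) |U|]; raised to the power [n], this is
   at most [(d / s^2)^(11 |U| / 12)].  The overlap of two random copies has
   exponential moments bounded by those of a Poisson variable of mean [s^2 / d],
   hence the chi-square distance tends to 0. *)

Set Implicit Arguments.
Unset Strict Implicit.
Unset Printing Implicit Defensive.

Import Order.TTheory GRing.Theory Num.Theory.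
Import numFieldNormedType.Exports.

Local Open Scope classical_set_scope.
Local Open Scope ring_scope.

(** * Squared Frobenius norms and the maximum principle *)

Section SumsOfSquares.
Variable R : realFieldType.

(** Lagrange's identity: twice the deficit is the sum of the squared minors
    [a i * b j - a j * b i]. *)
Lemma cauchy_schwarz_sum (I : finType) (P : pred I) (a b : I -> R) :
  (\sum_(i | P i) a i * b i) ^+ 2 <=
  (\sum_(i | P i) a i ^+ 2) * (\sum_(i | P i) b i ^+ 2).
Proof.
rewrite -subr_ge0 -(pmulr_rge0 _ (ltr0n R 2)).
suff -> : 2 * ((\sum_(i | P i) a i ^+ 2) * (\sum_(i | P i) b i ^+ 2) -
    (\sum_(i | P i) a i * b i) ^+ 2) =
    \sum_(i | P i) \sum_(j | P j) (a i * b j - a j * b i) ^+ 2.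
  by apply: sumr_ge0 => i _; apply: sumr_ge0 => j _; rewrite sqr_ge0.
pose c := \sum_(i | P i) \sum_(j | P j) a i ^+ 2 * b j ^+ 2.
pose e := \sum_(i | P i) \sum_(j | P j) a j ^+ 2 * b i ^+ 2.
pose f := \sum_(i | P i) \sum_(j | P j) (a i * b i) * (a j * b j).
have -> : \sum_(i | P i) \sum_(j | P j) (a i * b j - a j * b i) ^+ 2 =
    c + e - 2 * f.
  rewrite mulr_sumr -big_split -sumrB /=; apply: eq_bigr => i _.
  rewrite mulr_sumr -big_split -sumrB /=; apply: eq_bigr => j _; lra.
have ce : c = e by rewrite /c exchange_big.
by rewrite -ce /c /f -!big_distrlr /=; lra.
Qed.

(** The squared Frobenius norm, which avoids square roots over a general [realFieldType]. *)
Definition sumsq m n (A : 'M[R]_(m, n)) : R := \sum_i \sum_j A i j ^+ 2.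

Lemma sumsq_ge0 m n (A : 'M[R]_(m, n)) : 0 <= sumsq A.
Proof. by apply: sumr_ge0 => i _; apply: sumr_ge0 => j _; rewrite sqr_ge0. Qed.

Lemma sumsq_eq0 m n (A : 'M[R]_(m, n)) : sumsq A <= 0 -> A = 0.
Proof.
move=> A0; apply/matrixP => i j; rewrite mxE; apply/eqP.
rewrite -sqrf_eq0 eq_le sqr_ge0 andbT; apply: le_trans A0.
rewrite /sumsq (bigD1 i) //= (bigD1 j) //= -!addrA lerDl.
apply: addr_ge0; first by apply: sumr_ge0 => k _; rewrite sqr_ge0.
by apply: sumr_ge0 => k _; apply: sumr_ge0 => l _; rewrite sqr_ge0.
Qed.

Lemma sumsq_mulmx m n p (A : 'M[R]_(m, n)) (B : 'M[R]_(n, p)) :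
  sumsq (A *m B) <= sumsq A * sumsq B.
Proof.
rewrite /sumsq (exchange_big _ _ _ _ _ (fun i j => B i j ^+ 2)) /= big_distrlr.
apply: ler_sum => i _; apply: ler_sum => j _; rewrite mxE.
exact: cauchy_schwarz_sum.
Qed.

Lemma sumsq_le m n (A B : 'M[R]_(m, n)) :
  (forall i j, 0 <= A i j <= B i j) -> sumsq A <= sumsq B.
Proof.
move=> AB; apply: ler_sum => i _; apply: ler_sum => j _.
by have /andP[A0 leAB] := AB i j; rewrite lerXn2r // nnegrE (le_trans A0).
Qed.

(** Young's inequality: entrywise, the deficit is [c * (A i j - c^-1 * B i j) ^+ 2]. *)
Lemma sumsqD m n (A B : 'M[R]_(m, n)) (c : R) : 0 < c ->
  sumsq (A + B) <= (1 + c) * sumsq A + (1 + c^-1) * sumsq B.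
Proof.
move=> c0; rewrite /sumsq !mulr_sumr -big_split; apply: ler_sum => i _ /=.
rewrite !mulr_sumr -big_split; apply: ler_sum => j _ /=; rewrite mxE.
rewrite -subr_ge0.
suff -> : (1 + c) * A i j ^+ 2 + (1 + c^-1) * B i j ^+ 2 -
    (A i j + B i j) ^+ 2 = c * (A i j - c^-1 * B i j) ^+ 2.
  by rewrite mulr_ge0 ?sqr_ge0 // ltW.
have cV : c * c^-1 = 1 by rewrite mulfV ?gt_eqF.
rewrite [RHS](_ : _ = c * A i j ^+ 2 - 2 * (c * c^-1) * A i j * B i j +
  (c * c^-1) * c^-1 * B i j ^+ 2); last by lra.
by rewrite cV; lra.
Qed.

Lemma contraction_le0 (k a : R) : k < 1 -> a <= k * a -> a <= 0.
Proof. by move=> k1 ka; nra. Qed.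

(** The maximum principle: entrywise domination by [K *m A] makes the norm of [A] at most a strict
    fraction of itself. It is applied to positive or negative parts to compare solutions. *)
Lemma fixpoint_le0 m n (K : 'M[R]_m) (A : 'M[R]_(m, n)) :
  sumsq K < 1 -> (forall i j, 0 <= A i j <= (K *m A) i j) -> A = 0.
Proof.
move=> K1 /sumsq_le leA; apply: sumsq_eq0.
exact: contraction_le0 K1 (le_trans leA (sumsq_mulmx K A)).
Qed.

End SumsOfSquares.

(** * The resolvent and its comparison principle *)

Section Resolvent.
Variables (R : realFieldType) (d : nat) (K : 'M[R]_d).
Hypotheses (K_sym : K^T = K) (K_ge0 : forall i j, 0 <= K i j).
Hypothesis K_small : sumsq K <= 1 / 16.

Let K_lt1 : sumsq K < 1. Proof. by apply: le_lt_trans K_small _; lra. Qed.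

(** The Neumann series [K + K^2 + ...] in closed form, so that no convergence question arises. *)
Definition resolvent : 'M[R]_d := K *m invmx (1%:M - K).

Lemma resolvent_unit : 1%:M - K \in unitmx.
Proof.
rewrite -unitmx_tr -row_free_unit -kermx_eq0; apply/eqP.
set N := kermx _.
have /eqP : N *m (1%:M - K)^T = 0 by exact: mulmx_ker.
rewrite linearB /= trmx1 K_sym mulmxBr mulmx1 subr_eq0 => /eqP NK.
apply: sumsq_eq0; apply: contraction_le0 K_lt1 _; rewrite mulrC.
by rewrite {1}NK sumsq_mulmx.
Qed.

Lemma resolventE : resolvent = K + K *m resolvent.
Proof.
have /eqP := mulmxV resolvent_unit; rewrite mulmxBl mul1mx subr_eq => /eqP invE.
by rewrite /resolvent {1}invE mulmxDr mulmx1.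
Qed.

Lemma resolvent_sym : resolvent^T = resolvent.
Proof.
have com : K *m (1%:M - K) = (1%:M - K) *m K.
  by rewrite mulmxBr mulmxBl mulmx1 mul1mx.
rewrite /resolvent trmx_mul trmx_inv linearB /= trmx1 K_sym.
rewrite -[LHS](mulmxK resolvent_unit) -(mulmxA (invmx _)) com mulmxA.
by rewrite mulVmx ?mul1mx //; exact: resolvent_unit.
Qed.

(** By [resolventE] and [K >= 0], the negative part [N] of the resolvent satisfies [N <= K *m N], so
    it vanishes. *)
Lemma resolvent_ge0 i j : 0 <= resolvent i j.
Proof.
pose N : 'M[R]_d := \matrix_(i, j) Num.max 0 (- resolvent i j).
suff N0 : N = 0.
  have := congr1 (fun A : 'M[R]_d => A i j) N0; rewrite !mxE.
  by move/eqP; rewrite eq_le ge_max oppr_le0 => /andP[/andP[]].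
apply: (fixpoint_le0 K_lt1) => k l; rewrite mxE le_max lexx /=.
rewrite ge_max mxE; apply/andP; split.
  by apply: sumr_ge0 => h _; rewrite mulr_ge0 // mxE le_max lexx.
have -> : resolvent k l = K k l + (K *m resolvent) k l.
  by rewrite {1}resolventE mxE.
rewrite opprD -[leRHS]add0r lerD ?oppr_le0 //.
rewrite mxE -sumrN; apply: ler_sum => h _; rewrite -mulrN ler_wpM2l //.
by rewrite [leRHS]mxE le_max lexx orbT.
Qed.

Lemma resolvent_col (j : 'I_d) :
  sumsq (col j resolvent) <= 16 / 9 * sumsq (col j K).
Proof.
have colE : col j resolvent = col j K + K *m col j resolvent.
  by rewrite {1}resolventE linearD /= !colE mulmxA.
(* With [c = 1/3], the column norm [x] satisfies [x <= 4/3 k + 4/16 x], where [k] is that of [K];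
   hence [x <= 16/9 k]. *)
have c0 : 0 < 1 / 3 :> R by lra.
have := sumsqD (col j K) (K *m col j resolvent) c0; rewrite -colE mul1r invrK.
have := sumsq_mulmx K (col j resolvent).
have := sumsq_ge0 (col j resolvent) => *; have := K_small => *; nra.
Qed.

Lemma sumsq_resolvent : sumsq resolvent <= 1 / 9.
Proof.
have sumsqE (A : 'M[R]_d) : sumsq A = \sum_j sumsq (col j A).
  rewrite /sumsq exchange_big; apply: eq_bigr => j _; apply: eq_bigr => i _.
  by rewrite big_ord1 mxE.
rewrite sumsqE; apply: (@le_trans _ _ (\sum_j 16 / 9 * sumsq (col j K))).
  by apply: ler_sum => j _; exact: resolvent_col.
by rewrite -mulr_sumr -sumsqE; have := K_small => ?; lra.
Qed.

Lemma mul_resolvent_col (j : 'I_d) :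
  sumsq (col j (K *m resolvent)) <= 16 / 9 * sumsq K * sumsq (col j K).
Proof.
rewrite !colE -mulmxA -!colE; apply: le_trans (sumsq_mulmx _ _) _.
have := resolvent_col j; have := sumsq_ge0 K => *; have := K_small => *; nra.
Qed.

(** The right-hand side [r] solves the recursion with equality, up to the extra term [K r] on [T],
    which is nonnegative. So the positive part of [h - r] off [T] is a subsolution and vanishes. *)
Lemma resolvent_dominates (T : {set 'I_d}) (h : 'I_d -> R) (i : 'I_d) :
  (forall j, 0 <= h j) ->
  (forall j, j \notin T -> h j <= \sum_l K j l * h l) ->
  i \notin T -> h i <= \sum_(j in T) resolvent i j * h j.
Proof.
move=> h0 hK iT; pose r j := \sum_(l in T) resolvent j l * h l.
have r0 j : 0 <= r j by apply: sumr_ge0 => l _; rewrite mulr_ge0 ?resolvent_ge0.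
have rE j : r j = \sum_(l in T) K j l * h l + \sum_l K j l * r l.
  have -> : \sum_l K j l * r l = \sum_(k in T) (K *m resolvent) j k * h k.
    rewrite [RHS](eq_bigr (fun k => \sum_l K j l * resolvent l k * h k)); last first.
      by move=> k _; rewrite mxE mulr_suml.
    rewrite exchange_big; apply: eq_bigr => l _; rewrite /r mulr_sumr.
    by apply: eq_bigr => k _; rewrite mulrA.
  rewrite -big_split /r; apply: eq_bigr => l _ /=.
  by rewrite {1}resolventE mxE mulrDl.
pose v : 'cV[R]_d := \col_j (if j \in T then 0 else Num.max 0 (h j - r j)).
have v0 : v = 0.
  apply: (fixpoint_le0 K_lt1) => j k.
  have vge0 l : 0 <= v l k by rewrite mxE; case: ifP => // _; rewrite le_max lexx.
  have Kv0 : 0 <= (K *m v) j k by rewrite mxE sumr_ge0 // => l _; rewrite mulr_ge0.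
  rewrite vge0 /= {1}mxE; case: ifPn => // jT; rewrite ge_max Kv0 /= mxE.
  apply: le_trans (_ : \sum_(l | l \notin T) K j l * (h l - r l) <= _); last first.
    rewrite [leRHS](bigID (mem T)) /= -[leLHS]add0r; apply: lerD.
      by apply: sumr_ge0 => l _; rewrite mulr_ge0.
    apply: ler_sum => l lT; rewrite ler_wpM2l // mxE (negPf lT).
    by rewrite le_max lexx orbT.
  have := hK j jT; rewrite (bigID (mem T)) /= rE.
  rewrite [in X in _ - X](bigID (mem T) xpredT) /=.
  have : 0 <= \sum_(l in T) K j l * r l.
    by apply: sumr_ge0 => l _; rewrite mulr_ge0.
  have -> : \sum_(l | l \notin T) K j l * (h l - r l) =
      \sum_(l | l \notin T) K j l * h l - \sum_(l | l \notin T) K j l * r l.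
    by rewrite -sumrB; apply: eq_bigr => l _; rewrite mulrBr.
  by move=> *; lra.
have := congr1 (fun A : 'cV[R]_d => A i ord0) v0; rewrite !mxE (negPf iT).
by move/eqP; rewrite eq_le ge_max subr_le0 => /andP[/andP[]].
Qed.

End Resolvent.

(** * Set functions: insertion, deletion and energy *)

Section Toggle.
Variable I : finType.
Implicit Types (i j : I) (S T U : {set I}).

(** Symmetric difference with [{j}]; on products of spins it is multiplication by the spin at
    [j]. *)
Definition toggle j S : {set I} := [set i | (i \in S) (+) (i == j)]%SET.

Lemma in_toggle i j S : (i \in toggle j S) = (i \in S) (+) (i == j).
Proof. by rewrite inE. Qed.

Lemma toggleK j : involutive (toggle j).
Proof. by move=> S; apply/setP => i; rewrite !in_toggle addbK. Qed.

Lemma toggleC i j S : toggle i (toggle j S) = toggle j (toggle i S).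
Proof. by apply/setP => k; rewrite !in_toggle addbAC. Qed.

Lemma toggle_subset j S U : j \in U -> (toggle j S \subset U) = (S \subset U).
Proof.
move=> jU; apply/fintype.subsetP/fintype.subsetP => SU i iS.
  have [->//|ij] := eqVneq i j; apply: SU.
  by rewrite in_toggle iS (negPf ij).
have [->//|ij] := eqVneq i j; apply: SU.
by move: iS; rewrite in_toggle (negPf ij) addbF.
Qed.

Lemma toggleU1 j S : j \notin S -> toggle j S = (j |: S)%SET.
Proof.
move=> jS; apply/setP => i; rewrite in_toggle !inE.
by have [->|] := eqVneq i j; rewrite ?(negPf jS) ?addbF.
Qed.

Lemma toggleD1 j S : j \in S -> toggle j S = (S :\ j)%SET.
Proof.
move=> jS; apply/setP => i; rewrite in_toggle !inE.
by have [->|] := eqVneq i j; rewrite ?jS ?addbF ?andbT.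
Qed.

End Toggle.

Section SubsetEnergy.
Variables (R : realType) (I : finType) (m : {set I} -> R).
Implicit Types (U : {set I}) (w : I -> R).

Definition energy U : R := \sum_(S : {set I} | S \subset U) m S ^+ 2.

(** The quadratic form of the number operator at [m]. *)
Definition card_energy U : R :=
  \sum_(S : {set I} | S \subset U) #|S|%:R * m S ^+ 2.

Lemma energy_ge0 U : 0 <= energy U.
Proof. by apply: sumr_ge0 => S _; rewrite sqr_ge0. Qed.

Lemma card_energy_ge0 U : 0 <= card_energy U.
Proof. by apply: sumr_ge0 => S _; rewrite mulr_ge0 ?sqr_ge0. Qed.

Lemma card_energyE U : card_energy U =
  \sum_(i in U) \sum_(S : {set I} | S \subset U) (i \in S)%:R * m S ^+ 2.
Proof.
rewrite exchange_big; apply: eq_bigr => S SU /=; rewrite -mulr_suml.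
congr (_ * _); rewrite -natr_sum; congr _%:R; rewrite -sum1_card.
rewrite [LHS]big_mkcond [RHS]big_mkcond /=; apply: eq_bigr => i _.
by case: ifP => [/(fintype.subsetP SU) ->|]//; case: ifP.
Qed.

(** Toggling [i] exchanges the sets containing [i] with those avoiding it. The number operator thus
    becomes the sum of the squared norms of the deletion maps. *)
Lemma card_energy_toggle U : card_energy U =
  \sum_(i in U) \sum_(S : {set I} | S \subset U)
    (i \notin S)%:R * m (toggle i S) ^+ 2.
Proof.
rewrite card_energyE; apply: eq_bigr => i iU.
rewrite (reindex_inj (inv_inj (toggleK i))) /=; apply: eq_big => S.
  exact: toggle_subset.
by rewrite in_toggle eqxx addbT.
Qed.

(* Canonical commutation of raising and lowering: writing [a_j], [b_j] for the
   maps that insert, resp. delete, the element [j], the mixed terms of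
   |sum w_j a_j m|^2 and |sum w_j b_j m|^2 coincide. *)
Lemma raising_energy U w :
  \sum_(T : {set I} | T \subset U)
    (\sum_(j in U) w j * ((j \in T)%:R * m (toggle j T))) ^+ 2 <=
  (\sum_(j in U) w j ^+ 2) * (energy U + card_energy U).
Proof.
pose gram (a : I -> {set I} -> R) j l := \sum_(T : {set I} | T \subset U) a j T * a l T.
pose a (j : I) (T : {set I}) : R := (j \in T)%:R * m (toggle j T).
pose b (j : I) (T : {set I}) : R := (j \notin T)%:R * m (toggle j T).
have gramE c : \sum_(T : {set I} | T \subset U) (\sum_(j in U) w j * c j T) ^+ 2 =
    \sum_(j in U) \sum_(l in U) w j * w l * gram c j l.
  rewrite [LHS](eq_bigr (fun T => \sum_(j in U) \sum_(l in U)
    w j * w l * (c j T * c l T))) => [|T _]; last first.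
    rewrite expr2 big_distrlr /=; apply: eq_bigr => j _; apply: eq_bigr => l _.
    by rewrite mulrACA.
  rewrite exchange_big; apply: eq_bigr => j _; rewrite exchange_big.
  by apply: eq_bigr => l _; rewrite mulr_sumr.
have gram_neq j l : j \in U -> l \in U -> j != l -> gram a j l = gram b j l.
  move=> jU lU jl; rewrite /gram.
  rewrite (reindex_inj (inv_inj (toggleK j))) /=.
  rewrite (reindex_inj (inv_inj (toggleK l))) /=; apply: eq_big => T.
    by rewrite !toggle_subset.
  move=> _; rewrite /a /b !in_toggle !eqxx (negPf jl) eq_sym (negPf jl) !addbT.
  rewrite !addbF toggleK (toggleC j l) toggleK.
  by rewrite mulrACA [m _ * m _]mulrC mulrACA.
have gram_eq j : j \in U -> gram a j j <= energy U.
  move=> jU; rewrite /gram (reindex_inj (inv_inj (toggleK j))) /=.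
  rewrite (eq_bigl _ _ (fun T => toggle_subset T jU)); apply: ler_sum => T _.
  rewrite -expr2 /a toggleK exprMn; apply: ler_piMl; first exact: sqr_ge0.
  by case: (_ \in _); rewrite ?expr1n ?expr0n.
have gramb_ge0 j : 0 <= gram b j j.
  by apply: sumr_ge0 => T _; rewrite -expr2 sqr_ge0.
rewrite (gramE a) mulrDr.
apply: (@le_trans _ _ (\sum_(j in U) w j ^+ 2 * energy U +
    \sum_(j in U) \sum_(l in U) w j * w l * gram b j l)).
  rewrite -big_split /=; apply: ler_sum => j jU.
  rewrite (bigD1 j) //= [X in _ <= _ + X](bigD1 j) //= -expr2 addrA lerD //.
    rewrite -mulrDr ler_wpM2l ?sqr_ge0 // -[leLHS]addr0 lerD ?gram_eq //.
  apply: ler_sum => l /andP[lU lj]; rewrite gram_neq // eq_sym //.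
(* The [b] terms reassemble into a square for each [T]; Cauchy-Schwarz over [j] and the previous
   identity bound their sum through [card_energy]. *)
rewrite mulr_suml lerD2l -(gramE b) card_energy_toggle exchange_big mulr_sumr.
apply: ler_sum => T _; apply: le_trans (cauchy_schwarz_sum _ _ _) _.
rewrite ler_wpM2l ?sumr_ge0 // => [j _|]; first exact: sqr_ge0.
by apply: ler_sum => j _; rewrite /b exprMn -natrX; case: (_ \notin _).
Qed.


End SubsetEnergy.

Section EnergyBound.
Variables (R : realType) (I : finType) (m : {set I} -> R) (W : I -> I -> R).
Hypotheses (m_ge0 : forall S, 0 <= m S) (m0 : m finset.set0 = 1).
Hypothesis W_sym : forall i j, W i j = W j i.
Hypothesis m_le : forall i (T : {set I}), i \notin T ->
  m (toggle i T) <= \sum_(j in T) W i j * m (toggle j T).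
Implicit Types U : {set I}.

(** For [i] outside [U], the left-hand side is what [i] adds to the energy. By [m_le], each term is
    at most the square of the insertion map with weights [W i], to which [raising_energy]
    applies. *)
Lemma insertion_energy i U :
  \sum_(T : {set I} | T \subset U) (i \notin T)%:R * m (toggle i T) ^+ 2 <=
  (\sum_(j in U) W i j ^+ 2) * (energy m U + card_energy m U).
Proof.
apply: le_trans _ (raising_energy m U (W i)); apply: ler_sum => T TU.
have [iT|iT] := boolP (i \in T); first by rewrite mul0r sqr_ge0.
have mT : m (toggle i T) <= \sum_(j in U) W i j * ((j \in T)%:R * m (toggle j T)).
  apply: le_trans (m_le iT) _; rewrite le_eqVlt; apply/orP; left; apply/eqP.
  rewrite [LHS]big_mkcond [RHS]big_mkcond; apply: eq_bigr => j _.
  have [jT|jT] := boolP (j \in T); last by rewrite mul0r mulr0 if_same.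
  by rewrite (fintype.subsetP TU _ jT) mul1r.
by rewrite mul1r lerXn2r ?nnegrE // (le_trans (m_ge0 _) mT).
Qed.

(** Summing [insertion_energy] over [i] gives [N <= q (E + N)]; with [q <= 1/9] this solves to
    [N <= E / 8]. *)
Lemma card_energy_le U : \sum_(i in U) \sum_(j in U) W i j ^+ 2 <= 1 / 9 ->
  card_energy m U <= energy m U / 8.
Proof.
move=> q9; have := energy_ge0 m U; have := card_energy_ge0 m U.
suff : card_energy m U <=
    (\sum_(i in U) \sum_(j in U) W i j ^+ 2) * (energy m U + card_energy m U).
  move: q9; move: (\sum_(i in U) _) (energy _ _) (card_energy _ _) => q e n.
  by move=> *; nra.
rewrite {1}card_energy_toggle mulr_suml; apply: ler_sum => i _.
exact: insertion_energy.
Qed.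

Lemma energy_setU1 i U : i \notin U -> energy m (i |: U)%SET =
  energy m U + \sum_(T : {set I} | T \subset U) (i \notin T)%:R * m (toggle i T) ^+ 2.
Proof.
move=> iU; rewrite {1}/energy (bigID (fun S : {set I} => i \in S)) /= addrC.
congr (_ + _).
  apply: eq_bigl => S; rewrite andbC; apply/andP/idP => [[iS SU]|SU].
    apply/fintype.subsetP => j jS; have /setU1P[ji|//] := fintype.subsetP SU _ jS.
    by rewrite -ji jS in iS.
  split; last exact: fintype.subset_trans SU (finset.subsetUr _ _).
  by apply: contra iU => /(fintype.subsetP SU).
rewrite (reindex_inj (inv_inj (toggleK i))) /=.
have iT (T : {set I}) : T \subset U -> i \notin T.
  by move=> TU; apply: contra iU => /(fintype.subsetP TU).
apply: eq_big => T; last first.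
  by rewrite in_toggle eqxx addbT toggle_subset ?setU11 // => /andP[_ ->]; rewrite mul1r.
rewrite in_toggle eqxx addbT toggle_subset ?setU11 //=; apply/andP/idP => [[TU iT']|TU].
  apply/fintype.subsetP => j jT; have /setU1P[ji|//] := fintype.subsetP TU _ jT.
  by rewrite -ji jT in iT'.
by split; [exact: fintype.subset_trans TU (finset.subsetUr _ _)|exact: iT].
Qed.

(** Induction on [U]: adding [i] multiplies the energy by at most [1 + 9/8 r], because
    [E + N <= 9/8 E]. Meanwhile the double sum grows by at least [2 r], since [W] is symmetric; this
    gives the rate [9/16]. *)
Lemma energy_le_expR U : \sum_(i in U) \sum_(j in U) W i j ^+ 2 <= 1 / 9 ->
  energy m U <= expR (9 / 16 * \sum_(i in U) \sum_(j in U) W i j ^+ 2).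
Proof.
have [n] := ubnP #|U|; elim: n U => // n IHn U; rewrite ltnS => Un q9.
have [U0|[i iU]] := set_0Vmem U.
  rewrite U0 /energy (eq_bigl (pred1 finset.set0)) => [|S]; last by rewrite finset.subset0.
  by rewrite big_pred1_eq m0 finset.big_set0 mulr0 expR0 expr1n.
pose V := (U :\ i)%SET.
have UE : U = (i |: V)%SET by rewrite finset.setD1K.
have iV : i \notin V by rewrite finset.setD11.
pose q := \sum_(k in V) \sum_(j in V) W k j ^+ 2.
pose r := \sum_(j in V) W i j ^+ 2.
have r0 : 0 <= r by apply: sumr_ge0 => j _; exact: sqr_ge0.
have qE : \sum_(k in U) \sum_(j in U) W k j ^+ 2 = q + 2 * r + W i i ^+ 2.
  rewrite UE big_setU1 //= [X in X + _]big_setU1 //= -/r.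
  rewrite (eq_bigr (fun k => W k i ^+ 2 + \sum_(j in V) W k j ^+ 2)) => [|k _].
    rewrite big_split /= -/q.
    have -> : \sum_(k in V) W k i ^+ 2 = r by apply: eq_bigr => k _; rewrite W_sym.
    by lra.
  by rewrite big_setU1.
have Wii := sqr_ge0 (W i i).
have q9V : q <= 1 / 9 by rewrite qE in q9; lra.
have IH : energy m V <= expR (9 / 16 * q).
  by apply: IHn q9V; apply: leq_trans Un; rewrite [in X in (_ < X)%N](cardsD1 i) iU.
apply: (@le_trans _ _ (expR (9 / 16 * q) * (1 + 9 / 8 * r))).
  rewrite UE energy_setU1 //.
  apply: (@le_trans _ _ (energy m V * (1 + 9 / 8 * r))); last first.
    by rewrite ler_wpM2r //; lra.
  rewrite mulrDr mulr1 lerD2l; apply: le_trans (insertion_energy i V) _.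
  rewrite -/r; have := card_energy_le q9V; have := energy_ge0 m V.
  by move=> *; nra.
apply: (@le_trans _ _ (expR (9 / 16 * q) * expR (9 / 8 * r))).
  by rewrite ler_wpM2l ?expR_ge0 // expR_ge1Dx.
by rewrite -expRD ler_expR qE; lra.
Qed.

End EnergyBound.

(** * Walsh characters, Griffiths' and Simon's inequalities *)

Section SpinCorrelations.
Variables (R : realType) (d : nat).
Implicit Types (x y : config d) (S T : {set 'I_d}) (w : config d -> R).

Lemma spinM x i : spin R x i * spin R x i = 1.
Proof. by rewrite /spin -expr2 -exprM mulnC exprM sqrrN expr1n expr1n. Qed.

(** The Walsh character of the cube indexed by [S]. *)
Definition spin_prod S x : R := \prod_(i in S) spin R x i.

Lemma spin_prod_toggle i S x :
  spin_prod (toggle i S) x = spin R x i * spin_prod S x.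
Proof.
have [iS|iS] := boolP (i \in S).
  by rewrite toggleD1 // [in RHS]/spin_prod (big_setD1 _ iS) /= mulrA spinM mul1r.
by rewrite toggleU1 // /spin_prod big_setU1.
Qed.

Lemma sum_spin_prod S : \sum_x spin_prod S x = (S == finset.set0)%:R * 2 ^+ d.
Proof.
rewrite /spin_prod (eq_bigr (fun x : config d =>
  \prod_i (if i \in S then (-1) ^+ x i else 1 : R))) => [|x _]; last first.
  by rewrite big_mkcond.
rewrite -(bigA_distr_bigA (fun i (b : bool) => if i \in S then (-1) ^+ b else 1)) /=.
rewrite (eq_bigr (fun i => if i \in S then 0 else 2 : R)) => [|i _]; last first.
  by rewrite big_bool /=; case: ifP => _; rewrite ?expr1 ?expr0 ?addNr.
have [->|/finset.set0Pn[i iS]] := eqVneq S finset.set0; last first.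
  by rewrite mul0r (bigD1 i) //= iS mul0r.
rewrite mul1r (eq_bigr (fun=> 2)) => [|i _]; last by rewrite finset.in_set0.
by rewrite prodr_const card_ord.
Qed.

(** The sum over [S] factors as the product over sites of [1 + x_i y_i], and a site where [x] and
    [y] differ contributes 0. *)
Lemma spin_prod_orthogonal x y :
  \sum_S spin_prod S x * spin_prod S y = (x == y)%:R * 2 ^+ d.
Proof.
rewrite (eq_bigr (fun S => \prod_i (if i \in S then spin R x i * spin R y i else 1))).
  rewrite -(bigA_distr _ _ (fun i => spin R x i * spin R y i) (fun=> 1)) /=.
  have [->|] := eqVneq x y.
    rewrite (eq_bigr (fun=> 2)) => [|i _]; last by rewrite spinM.
    by rewrite prodr_const card_ord mul1r.
  move=> xy; have [i xyi] : exists i, x i != y i.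
    by apply/existsP; apply: contraR xy; rewrite negb_exists => /forallP xy;
      apply/eqP/ffunP => i; apply/eqP; rewrite -[_ == _]negbK.
  rewrite mul0r (bigD1 i) //= [X in X * _](_ : _ = 0) ?mul0r // /spin.
  by case: (x i) (y i) xyi => [] [] //= _; rewrite expr0 expr1 ?mulr1 ?mul1r addNr.
by move=> S _; rewrite -big_mkcond -big_split.
Qed.

Definition spin_corr w S : R := \sum_x spin_prod S x * w x.

Lemma parseval w w' :
  \sum_S spin_corr w S * spin_corr w' S = 2 ^+ d * \sum_x w x * w' x.
Proof.
rewrite (eq_bigr (fun S : {set 'I_d} => \sum_x \sum_y
    w x * w' y * (spin_prod S x * spin_prod S y))) => [|S _]; last first.
  rewrite /spin_corr big_distrlr /=; apply: eq_bigr => x _; apply: eq_bigr => y _.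
  by rewrite mulrACA mulrC.
rewrite exchange_big mulr_sumr; apply: eq_bigr => x _.
rewrite exchange_big (bigD1 x) //= -mulr_sumr spin_prod_orthogonal eqxx mul1r.
rewrite big1 ?addr0 => [|y yx]; first by rewrite mulrC.
by rewrite -mulr_sumr spin_prod_orthogonal eq_sym (negPf yx) mul0r mulr0.
Qed.

Section EdgeWeights.
Variables (a b tau : 'I_d * 'I_d -> R).
Hypotheses (a_ge0 : forall e, 0 <= a e) (b_ge0 : forall e, 0 <= b e).
Hypotheses (tau_ge0 : forall e, 0 <= tau e) (b_le : forall e, b e <= tau e * a e).
Implicit Types (e : 'I_d * 'I_d) (L : seq ('I_d * 'I_d)).

(** The high-temperature form of a Gibbs weight: [a], [b] and [tau] stand for [cosh], [sinh] and a
    bound on [tanh]. The edges form a sequence so that they can be expanded one at a time. *)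
Definition edge_weight L x : R :=
  \prod_(e <- L) (a e + b e * (spin R x e.1 * spin R x e.2)).

Lemma spin_corr_cons e L S : spin_corr (edge_weight (e :: L)) S =
  a e * spin_corr (edge_weight L) S +
  b e * spin_corr (edge_weight L) (toggle e.1 (toggle e.2 S)).
Proof.
rewrite /spin_corr !mulr_sumr -big_split; apply: eq_bigr => x _ /=.
by rewrite !spin_prod_toggle /edge_weight big_cons; lra.
Qed.

(** Griffiths' first inequality: expanding the edges leaves a nonnegative combination of sums of
    characters, each of which is 0 or [2 ^+ d]. *)
Lemma spin_corr_ge0 L S : 0 <= spin_corr (edge_weight L) S.
Proof.
elim: L S => [|e L IH] S; last by rewrite spin_corr_cons addr_ge0 // mulr_ge0.
rewrite /spin_corr (eq_bigr (spin_prod S)) => [|x _]; last first.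
  by rewrite /edge_weight big_nil mulr1.
by rewrite sum_spin_prod mulr_ge0 ?exprn_ge0.
Qed.

(** The edges summed over ([L]) are kept apart from those of the weight ([L']), as the induction
    peels an edge off each separately. *)
Let nbr_sum (i : 'I_d) L L' T : R := \sum_(e <- L) tau e *
  ((e.1 == i)%:R * spin_corr (edge_weight L') (toggle e.2 T) +
   (e.2 == i)%:R * spin_corr (edge_weight L') (toggle e.1 T)).

Let nbr_sum_ge0 i L L' T : 0 <= nbr_sum i L L' T.
Proof.
by apply: sumr_ge0 => e _; rewrite mulr_ge0 // addr_ge0 // mulr_ge0 // spin_corr_ge0.
Qed.

(* Simon's inequality: in the high-temperature expansion some edge of odd
   multiplicity leaves the source [i]; removing it moves the source to the other
   end of the edge. *)
Lemma simon_edges L (i : 'I_d) T : i \notin T ->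
  spin_corr (edge_weight L) (toggle i T) <= nbr_sum i L L T.
Proof.
elim: L T => [|e L IH] T iT.
  rewrite /nbr_sum big_nil /spin_corr (eq_bigr (spin_prod (toggle i T))) => [|x _].
    rewrite sum_spin_prod; have [/setP/(_ i)|] := eqVneq; last by rewrite mul0r.
    by rewrite in_toggle eqxx (negPf iT) finset.in_set0.
  by rewrite /edge_weight big_nil mulr1.
set T' := toggle e.1 (toggle e.2 T).
have consE : nbr_sum i (e :: L) (e :: L) T = tau e *
    ((e.1 == i)%:R * spin_corr (edge_weight (e :: L)) (toggle e.2 T) +
     (e.2 == i)%:R * spin_corr (edge_weight (e :: L)) (toggle e.1 T)) +
    (a e * nbr_sum i L L T + b e * nbr_sum i L L T').
  rewrite {1}/nbr_sum big_cons; congr (_ + _).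
  rewrite /nbr_sum !mulr_sumr -big_split; apply: eq_bigr => f _ /=.
  rewrite !spin_corr_cons /T' !(toggleC _ e.1) !(toggleC _ e.2).
  by rewrite !(toggleC _ e.1); lra.
have IHT := IH T iT.
(* Of the two terms of the expansion at [e], one absorbs [b e] by [b_le] and the other is
   nonnegative. *)
have tauE S : b e * spin_corr (edge_weight L) S <= tau e * spin_corr (edge_weight (e :: L)) S.
  rewrite spin_corr_cons mulrDr mulrA -[leLHS]addr0 lerD //.
    by rewrite ler_wpM2r ?spin_corr_ge0.
  by rewrite !mulr_ge0 ?spin_corr_ge0.
have LHSE : spin_corr (edge_weight (e :: L)) (toggle i T) =
    a e * spin_corr (edge_weight L) (toggle i T) +
    b e * spin_corr (edge_weight L) (toggle i T').
  by rewrite spin_corr_cons /T' (toggleC i e.1) (toggleC i e.2).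
have aIH := ler_wpM2l (a_ge0 e) IHT.
have b0 := mulr_ge0 (b_ge0 e) (nbr_sum_ge0 i L L T').
(* If [i] is outside [T'], the induction hypothesis applies to both [T] and [T']. Otherwise exactly
   one end of [e] is [i]; then [toggle i T'] is [T] toggled at the other end, and the [b e] term is
   covered by the summand of [e]. *)
have [iT'|iT'] := boolP (i \in T'); last first.
  rewrite consE LHSE -[leLHS]add0r lerD //.
    by rewrite mulr_ge0 // addr_ge0 // mulr_ge0 // spin_corr_ge0.
  by rewrite lerD // ler_wpM2l // IH.
move: (iT'); rewrite /T' !in_toggle (negPf iT) /= => iE.
have [e2|e2] := eqVneq i e.2.
  have e1 : (e.1 == i) = false by move: iE; rewrite e2 eqxx eq_sym; case: (_ == _).
  have TE : toggle i T' = toggle e.1 T by rewrite /T' e2 toggleC toggleK.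
  rewrite consE LHSE TE e1 -e2 eqxx mul0r add0r mul1r.
  by have := tauE (toggle e.1 T); lra.
have e1 : i = e.1 by move: iE; rewrite (negPf e2) /= => /eqP.
have TE : toggle i T' = toggle e.2 T by rewrite /T' e1 toggleK.
rewrite consE LHSE TE -e1 eqxx eq_sym (negPf e2) mul0r addr0 mul1r.
by have := tauE (toggle e.2 T); lra.
Qed.

End EdgeWeights.

End SpinCorrelations.

Section SinhCosh.
Variable R : realType.

(** This is [tanh t <= t]. The function [f] is [2 (x cosh x - sinh x)], with derivative
    [2 x sinh x >= 0] on the segment from 0 to [t]. *)
Lemma sinh_le_mul_cosh (t : R) : 0 <= t ->
  (expR t - expR (- t)) / 2 <= t * ((expR t + expR (- t)) / 2).
Proof.
move=> t0; pose f (x : R) := (1 + x) * expR (- x) - (1 - x) * expR x.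
pose f' (x : R) := x * (expR x - expR (- x)).
suff f0 : f 0 <= f t.
  by move: f0; rewrite /f oppr0 expR0 => f0; lra.
have df (x : R) : is_derive x (1 : R) f (f' x).
  rewrite /f; apply: is_derive_eq.
  by rewrite /f' /GRing.scale /=; lra.
have cf : {within `[0, t], continuous f}.
  apply: continuous_subspaceT => x; apply: differentiable_continuous.
  by apply/derivable1_diffP; case: (df x).
have [c] := MVT_segment t0 (fun x _ => df x) cf.
rewrite in_itv /= subr0 => /andP[c0 ct] fE; rewrite -subr_ge0 fE /f'.
by rewrite !mulr_ge0 // subr_ge0 ler_expR; lra.
Qed.

Lemma sinh_ge0 (t : R) : 0 <= t -> 0 <= (expR t - expR (- t)) / 2.
Proof. by move=> t0; rewrite divr_ge0 // subr_ge0 ler_expR; lra. Qed.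

End SinhCosh.

(** * Correlations of the Ising model *)

Section IsingCorrelations.
Variables (R : realType) (d : nat) (Theta : 'M[R]_d).
Hypotheses (Theta_sym : Theta^T = Theta) (Theta_ge0 : forall i j, 0 <= Theta i j).
Implicit Types (x : config d) (S T U : {set 'I_d}).

Lemma expR_spin (t : R) x i j : expR (t * spin R x i * spin R x j) =
  (expR t + expR (- t)) / 2 + (expR t - expR (- t)) / 2 * (spin R x i * spin R x j).
Proof.
rewrite -mulrA /spin; case: (x i) (x j) => [] [];
  by rewrite /= ?expr0 ?expr1 ?(mulr1, mul1r, mulrN1, mulN1r, opprK); lra.
Qed.

Let a (e : 'I_d * 'I_d) := (expR (Theta e.1 e.2) + expR (- Theta e.1 e.2)) / 2.
Let b (e : 'I_d * 'I_d) := (expR (Theta e.1 e.2) - expR (- Theta e.1 e.2)) / 2.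

Lemma ising_weight_edges :
  ising_weight Theta = edge_weight a b (index_enum _).
Proof.
apply/funext => x; rewrite /ising_weight pair_bigA expR_sum /edge_weight /=.
by apply: eq_bigr => e _; rewrite expR_spin.
Qed.

Let a_ge0 e : 0 <= a e.
Proof. by rewrite divr_ge0 // addr_ge0 ?expR_ge0. Qed.

Let b_ge0 e : 0 <= b e. Proof. exact: sinh_ge0. Qed.

Let b_le e : b e <= Theta e.1 e.2 * a e. Proof. exact: sinh_le_mul_cosh. Qed.

Lemma partition_function_gt0 : 0 < partition_function Theta.
Proof.
rewrite /partition_function (bigD1 [ffun=> false]) //= ltr_wpDr ?expR_gt0 //.
by apply: sumr_ge0 => x _; exact: expR_ge0.
Qed.

Lemma ising_pmf_ge0 x : 0 <= ising_pmf Theta x.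
Proof. by rewrite divr_ge0 ?expR_ge0 // ltW // partition_function_gt0. Qed.

Lemma sum_ising_pmf : \sum_x ising_pmf Theta x = 1.
Proof. by rewrite -mulr_suml mulfV // gt_eqF // partition_function_gt0. Qed.

Definition ising_corr S : R := spin_corr (ising_pmf Theta) S.

Lemma ising_corrE S :
  ising_corr S = spin_corr (ising_weight Theta) S / partition_function Theta.
Proof.
by rewrite [RHS]mulr_suml; apply: eq_bigr => x _; rewrite /ising_pmf mulrA.
Qed.

Lemma ising_corr_ge0 S : 0 <= ising_corr S.
Proof.
rewrite ising_corrE divr_ge0 // ?(ltW partition_function_gt0) //.
by rewrite ising_weight_edges spin_corr_ge0.
Qed.

Lemma ising_corr0 : ising_corr finset.set0 = 1.
Proof.
rewrite -sum_ising_pmf; apply: eq_bigr => x _.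
by rewrite /spin_prod finset.big_set0 mul1r.
Qed.

(** Normalizing [simon_edges] cancels the partition function. The exponent contains both ordered
    pairs of each edge, hence the coefficient [2 Theta]. *)
Lemma simon_ising (i : 'I_d) T : i \notin T ->
  ising_corr (toggle i T) <= \sum_j (Theta *+ 2) i j * ising_corr (toggle j T).
Proof.
move=> iT; rewrite ising_corrE.
under eq_bigr do rewrite ising_corrE mulrA.
rewrite -mulr_suml ler_wpM2r ?invr_ge0 ?(ltW partition_function_gt0) //.
rewrite ising_weight_edges.
apply: le_trans (simon_edges a_ge0 b_ge0 (fun e => Theta_ge0 e.1 e.2) b_le _ iT) _.
set c := spin_corr _.
rewrite -(pair_bigA _ (fun k l => Theta k l * ((k == i)%:R * c (toggle l T) +
   (l == i)%:R * c (toggle k T)))) /=.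
rewrite (eq_bigr (fun k => \sum_l (k == i)%:R * (Theta k l * c (toggle l T)) +
   \sum_l (l == i)%:R * (Theta k l * c (toggle k T)))) => [|k _]; last first.
  by rewrite -big_split; apply: eq_bigr => l _ /=; lra.
rewrite big_split /= [X in _ + X]exchange_big /= -big_split /=.
rewrite (bigD1 i) //= [X in _ + X <= _]big1 ?addr0 => [|k ki]; last first.
  rewrite -big_split big1 // => l _.
  by rewrite /= (negPf ki) !mul0r addr0.
rewrite -big_split /= le_eqVlt; apply/orP; left; apply/eqP.
apply: eq_bigr => l _; rewrite eqxx !mul1r mulr2n !mxE.
by rewrite -[in Theta l i]Theta_sym mxE; lra.
Qed.

(** All coefficients of Simon's inequality at the source [i] vanish, while correlations are
    nonnegative. *)
Lemma ising_corr_isolated (i : 'I_d) S :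
  (forall j, Theta i j = 0) -> i \in S -> ising_corr S = 0.
Proof.
move=> Theta0 iS; apply/eqP; rewrite eq_le ising_corr_ge0 andbT.
have := @simon_ising i (toggle i S); rewrite in_toggle eqxx iS toggleK => /(_ isT).
by rewrite big1 // => j _; rewrite mulr2n mxE Theta0 addr0 mul0r.
Qed.

Lemma ising_energy U : sumsq (Theta *+ 2) <= 1 / 16 ->
  energy ising_corr U <=
  expR (9 / 16 * \sum_(i in U) \sum_(j in U) resolvent (Theta *+ 2) i j ^+ 2).
Proof.
move=> K_small.
have K_sym : (Theta *+ 2)^T = Theta *+ 2 by rewrite linearMn /= Theta_sym.
have K_ge0 i j : 0 <= (Theta *+ 2) i j by rewrite mulr2n mxE addr_ge0.
apply: energy_le_expR => //.
- exact: ising_corr_ge0.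
- exact: ising_corr0.
- by move=> i j; rewrite -[in LHS](resolvent_sym K_sym K_small) mxE.
- move=> i T iT.
  apply: (resolvent_dominates K_sym K_ge0 K_small (h := fun j => ising_corr (toggle j T))) => //.
    by move=> j; exact: ising_corr_ge0.
  by move=> j jT; exact: simon_ising.
apply: le_trans (sumsq_resolvent K_sym K_small).
rewrite /sumsq [leLHS]big_mkcond; apply: ler_sum => i _.
have row0 (P : pred 'I_d) : \sum_(j | P j) resolvent (Theta *+ 2) i j ^+ 2 <=
    \sum_j resolvent (Theta *+ 2) i j ^+ 2.
  by rewrite big_mkcond; apply: ler_sum => j _; case: ifP; rewrite ?sqr_ge0.
case: ifP => _; first exact: row0.
by apply: sumr_ge0 => j _; rewrite sqr_ge0.
Qed.

End IsingCorrelations.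

(* By Parseval the left-hand side is [sum_S m(S) m'(S)], and correlations involving
   an isolated vertex vanish. *)
Lemma ising_second_moment (R : realType) d (Theta Theta' : 'M[R]_d) (V V' : {set 'I_d}) :
  Theta^T = Theta -> (forall i j, 0 <= Theta i j) ->
  Theta'^T = Theta' -> (forall i j, 0 <= Theta' i j) ->
  (forall i j, i \notin V -> Theta i j = 0) ->
  (forall i j, i \notin V' -> Theta' i j = 0) ->
  2 ^+ d * \sum_x ising_pmf Theta x * ising_pmf Theta' x <=
  (energy (ising_corr Theta) (V :&: V')%SET +
   energy (ising_corr Theta') (V :&: V')%SET) / 2.
Proof.
move=> sy ge sy' ge' V0 V'0; rewrite -parseval.
rewrite (bigID (fun S : {set 'I_d} => S \subset V :&: V')%SET) /=.
rewrite [X in _ + X]big1 ?addr0 => [|S /fintype.subsetPn[i iS]]; last first.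
  rewrite finset.in_setI negb_and => /orP[/V0 Z|/V'0 Z].
    by rewrite -/(ising_corr Theta S) (ising_corr_isolated sy ge Z iS) mul0r.
  by rewrite -/(ising_corr Theta' S) (ising_corr_isolated sy' ge' Z iS) mulr0.
rewrite -big_split mulr_suml; apply: ler_sum => S _ /=.
rewrite -/(ising_corr Theta S) -/(ising_corr Theta' S).
by have := sqr_ge0 (ising_corr Theta S - ising_corr Theta' S) => ?; nra.
Qed.

(** * Edge counts, arboricity and relabelled graphs *)

Section GraphSums.
Variables (R : realType) (d : nat).
Implicit Types (G : rel 'I_d) (U : {set 'I_d}).

Lemma edges_double_sum G U : simple_graph G ->
  \sum_(i in U) \sum_(j in U) (G i j)%:R = 2 * #|edges (restrict_graph G U)|%:R :> R.
Proof.
move=> [G_sym G_irr]; pose H := restrict_graph G U.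
have -> : \sum_(i in U) \sum_(j in U) (G i j)%:R = \sum_i \sum_j (H i j)%:R :> R.
  rewrite big_mkcond; apply: eq_bigr => i _; case: ifP => iU.
    rewrite big_mkcond; apply: eq_bigr => j _; rewrite /H /restrict_graph iU.
    by case: ifP; rewrite ?andbT ?andbF.
  by rewrite big1 // => j _; rewrite /H /restrict_graph iU andbF.
have cardE : #|edges H|%:R = \sum_(i < d) \sum_(j < d) ((i < j)%N && H i j)%:R :> R.
  rewrite pair_bigA -sum1_card natr_sum big_mkcond; apply: eq_bigr => e _.
  by rewrite inE; case: ifP.
rewrite cardE mulr2n mulrDl mul1r [X in _ = _ + X]exchange_big -big_split /=.
apply: eq_bigr => i _; rewrite -big_split; apply: eq_bigr => j _ /=.
have -> : H j i = H i j by rewrite /H /restrict_graph G_sym andbA andbAC -andbA.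
have [->|ij] := eqVneq i j.
  by rewrite ltnn /H /restrict_graph G_irr addr0.
case: (ltngtP i j) => [ij'|ij'|/val_inj ij']; rewrite ?addr0 ?add0r //.
by rewrite ij' eqxx in ij.
Qed.

Lemma arboricity_ge0 G : 0 <= arboricity R G.
Proof. by rewrite ceil_ge0 (lt_le_trans _ (bigmax_ge_id _ _ _ _)). Qed.

Lemma double_sum_le_arboricity G U : simple_graph G ->
  \sum_(i in U) \sum_(j in U) (G i j)%:R <=
  2 * (arboricity R G)%:~R * #|U|%:R :> R.
Proof.
move=> simpleG; rewrite edges_double_sum // -mulrA ler_wpM2l //.
have arb0 : 0 <= (arboricity R G)%:~R :> R by rewrite ler0z arboricity_ge0.
(* The denominator [#|U| - 1] is positive only from two vertices on; smaller sets span no edge. *)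
have [U1|U1] := leqP #|U| 1.
  rewrite (_ : edges _ = finset.set0) ?cards0 ?mulr_ge0 //.
  apply/setP => -[i j]; rewrite !inE /=; apply/negP => /and4P[ij _ iU jU].
  by have := card_le1_eqP U1 i j iU jU => ijE; rewrite ijE ltnn in ij.
apply: (@le_trans _ _ ((arboricity R G)%:~R * (#|U|%:R - 1))); last first.
  by rewrite ler_wpM2l // gerBl.
rewrite -ler_pdivrMr ?subr_gt0 ?ltr1n //.
by apply: le_trans (ceil_ge _); apply: (le_bigmax _ (fun V : {set 'I_d} =>
  #|edges (restrict_graph G V)|%:R / (#|V|%:R - 1) : R)).
Qed.

Lemma frobenius_adjacency G :
  frobenius_norm (adjacency R G) ^+ 2 = \sum_i \sum_j (G i j)%:R.
Proof.
rewrite sqr_sqrtr; last by apply: sumr_ge0 => i _; apply: sumr_ge0 => j _; rewrite sqr_ge0.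
apply: eq_bigr => i _; apply: eq_bigr => j _; rewrite mxE.
by case: (G i j); rewrite ?expr1n ?expr0n.
Qed.

(** The inverse makes [p] itself an isomorphism from [G] to its copy. *)
Definition perm_graph (p : {perm 'I_d}) G : rel 'I_d :=
  fun i j => G (p^-1 i)%g (p^-1 j)%g.

Lemma perm_graph_simple p G : simple_graph G -> simple_graph (perm_graph p G).
Proof. by move=> [G_sym G_irr]; split => [i j|i]; rewrite /perm_graph. Qed.

Lemma perm_graph_isomorphic p G : isomorphic (perm_graph p G) G.
Proof. by exists p => i j; rewrite /perm_graph !permK. Qed.

Lemma non_isolated_perm p G :
  non_isolated (perm_graph p G) = (p @: non_isolated G)%SET.
Proof.
apply/setP => i; rewrite -[i in RHS](permKV p) mem_imset; last exact: perm_inj.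
rewrite !inE; apply/existsP/existsP => -[j ij]; first by exists (p^-1 j)%g.
by exists (p j); rewrite /perm_graph permK.
Qed.

Lemma double_sum_perm p G U :
  \sum_(i in U) \sum_(j in U) (perm_graph p G i j)%:R =
  \sum_(i in (p @^-1: U)%SET) \sum_(j in (p @^-1: U)%SET) (G i j)%:R :> R.
Proof.
rewrite (reindex_inj (@perm_inj _ p)) /=; apply: eq_big => [i|i _].
  by rewrite inE.
rewrite (reindex_inj (@perm_inj _ p)) /=; apply: eq_big => [j|j _].
  by rewrite inE.
by rewrite /perm_graph !permK.
Qed.

Lemma double_sumT_perm p G :
  \sum_i \sum_j (perm_graph p G i j)%:R = \sum_i \sum_j (G i j)%:R :> R.
Proof.
rewrite (reindex_inj (@perm_inj _ p)) /=; apply: eq_bigr => i _.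
rewrite (reindex_inj (@perm_inj _ p)) /=; apply: eq_bigr => j _.
by rewrite /perm_graph !permK.
Qed.

Lemma card_preim_perm (p : {perm 'I_d}) U : #|(p @^-1: U)%SET| = #|U|.
Proof. exact: card_preimset (@perm_inj _ p). Qed.

End GraphSums.

(** * Energy bound for one graph model *)

Section ResolventBlock.
Variables (R : realType) (d : nat) (G : rel 'I_d) (theta r : R).
Hypothesis G_simple : simple_graph G.

Let K : 'M[R]_d := (theta *: adjacency R G) *+ 2.
Let f2 : R := \sum_i \sum_j (G i j)%:R.
Let s : R := #|non_isolated G|%:R.

Hypothesis theta_ge0 : 0 <= theta.
Hypothesis norm_le : 64 * theta ^+ 2 * f2 <= 1.
Hypothesis calB_le : theta ^+ 2 * (512 * (f2 * Num.min f2 s)) <= r.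
Hypothesis density : forall U : {set 'I_d},
  \sum_(i in U) \sum_(j in U) (G i j)%:R <= 2 * r * #|U|%:R.

Let KE i j : K i j ^+ 2 = 4 * theta ^+ 2 * (G i j)%:R.
Proof.
rewrite /K mulr2n !mxE; case: (G i j); first by rewrite !mulr1; lra.
by rewrite mulr0 addr0 expr0n mulr0.
Qed.

Let sumsqK : sumsq K = 4 * theta ^+ 2 * f2.
Proof.
rewrite /sumsq mulr_sumr; apply: eq_bigr => i _; rewrite mulr_sumr.
by apply: eq_bigr => j _; rewrite KE.
Qed.

Lemma sumsq_edge_matrix : sumsq K <= 1 / 16.
Proof. by have := norm_le; rewrite sumsqK => ?; lra. Qed.

Let K_sym : K^T = K.
Proof.
have [G_sym _] := G_simple; rewrite /K; apply/matrixP => i j.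
by rewrite !mulr2n !mxE G_sym.
Qed.

Let K_ge0 i j : 0 <= K i j.
Proof. by rewrite /K mulr2n !mxE addr_ge0 // mulr_ge0. Qed.

(** Up to the factor [4 theta^2], a column contributes a degree. Each degree is at most [s], and for
    nonempty [U] the degrees in [U] total at most [f2 <= #|U| f2]. The two bounds match the two
    terms of [calB]. *)
Let colK_sum (U : {set 'I_d}) : \sum_(j in U) sumsq (col j K) <=
  4 * theta ^+ 2 * (#|U|%:R * Num.min f2 s).
Proof.
have colK j : sumsq (col j K) = 4 * theta ^+ 2 * \sum_i (G i j)%:R.
  rewrite /sumsq mulr_sumr; apply: eq_bigr => i _.
  by rewrite big_ord1 mxE KE.
rewrite (eq_bigr _ (fun j _ => colK j)) -mulr_sumr.
rewrite ler_wpM2l ?mulr_ge0 ?sqr_ge0 //.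
have [->|U0] := eqVneq U finset.set0.
  by rewrite finset.big_set0 cards0 mul0r.
have U1 : 1 <= #|U|%:R :> R by rewrite ler1n card_gt0.
have f20 : 0 <= f2 by apply: sumr_ge0 => i _; apply: sumr_ge0.
have [_|_] := leP f2 s.
  apply: (@le_trans _ _ f2); last by rewrite ler_peMl.
  rewrite /f2 [leRHS]exchange_big [leLHS]big_mkcond; apply: ler_sum => j _.
  by case: ifP => // _; apply: sumr_ge0 => i _.
rewrite mulr_natl -sumr_const; apply: ler_sum => j _.
rewrite /s -sum1_card natr_sum [leRHS]big_mkcond; apply: ler_sum => i _ /=.
rewrite inE; case: existsP => [_|nG]; first by case: (G i j).
by case Gij: (G i j) => //; case: nG; exists j.
Qed.

(** Split [W = K + Y]. The density hypothesis gives [k <= 8 theta^2 r |U|] for the block of [K]. The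
    block of [Y] is second order, and [calB_le] gives [y <= theta^2 r |U| / 18], with
    [1/18 = (256/9) / 512]. The resulting constant [11/2] is below the 6 in the condition on
    [theta]. *)
Lemma resolvent_block (U : {set 'I_d}) :
  9 / 16 * (\sum_(i in U) \sum_(j in U) resolvent K i j ^+ 2) <=
  11 / 2 * theta ^+ 2 * r * #|U|%:R.
Proof.
pose Y := K *m resolvent K; have Ksmall := sumsq_edge_matrix.
pose k := \sum_(i in U) \sum_(j in U) K i j ^+ 2.
pose y := \sum_(i in U) \sum_(j in U) Y i j ^+ 2.
have block : \sum_(i in U) \sum_(j in U) resolvent K i j ^+ 2 <=
    13 / 12 * k + 13 * y.
  rewrite !mulr_sumr -big_split; apply: ler_sum => i _ /=.
  rewrite !mulr_sumr -big_split; apply: ler_sum => j _ /=.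
  rewrite (resolventE K_sym Ksmall) [X in X ^+ 2]mxE -/Y.
  (* Young's inequality with parameter [1/12]: the cheap factor [13/12] goes to the dominant term
     [K]. *)
  move: (K i j) (Y i j) => u v; have := sqr_ge0 (u - 12 * v) => ?; nra.
have kE : k <= 4 * theta ^+ 2 * (2 * r * #|U|%:R).
  apply: le_trans (_ : 4 * theta ^+ 2 * \sum_(i in U) \sum_(j in U) (G i j)%:R <= _).
    rewrite /k mulr_sumr; apply: ler_sum => i _; rewrite mulr_sumr.
    by apply: ler_sum => j _; rewrite KE.
  by rewrite ler_wpM2l ?mulr_ge0 ?sqr_ge0.
have yE : y <= 16 / 9 * sumsq K * (4 * theta ^+ 2 * (#|U|%:R * Num.min f2 s)).
  apply: (@le_trans _ _ (\sum_(j in U) 16 / 9 * sumsq K * sumsq (col j K))); last first.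
    by rewrite -mulr_sumr ler_wpM2l // mulr_ge0 ?sumsq_ge0.
  rewrite /y [leLHS]exchange_big /=; apply: ler_sum => j _.
  apply: le_trans (mul_resolvent_col K_sym Ksmall j).
  rewrite /sumsq [leLHS]big_mkcond; apply: ler_sum => i _.
  rewrite big_ord1 [in leRHS]mxE -/Y.
  by case: ifP; rewrite ?sqr_ge0.
have yE' : y <= theta ^+ 2 * #|U|%:R * r / 18.
  apply: le_trans yE _; rewrite sumsqK.
  have := ler_wpM2l (_ : 0 <= theta ^+ 2 * #|U|%:R) calB_le.
  rewrite mulr_ge0 ?sqr_ge0 // => /(_ isT) ?; lra.
(* The bounds add up to the constant [169/32]; rounding it up to [11/2] uses the sign of this
   product. *)
have : 0 <= theta ^+ 2 * #|U|%:R * r.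
  have y0 : 0 <= y.
    by apply: sumr_ge0 => i _; apply: sumr_ge0 => j _; exact: sqr_ge0.
  by have := le_trans y0 yE' => ?; lra.
by move=> ?; lra.
Qed.

Lemma graph_energy_le (U : {set 'I_d}) :
  energy (ising_corr (theta *: adjacency R G)) U <=
  expR (11 / 2 * theta ^+ 2 * r * #|U|%:R).
Proof.
apply: le_trans (_ : expR (9 / 16 * \sum_(i in U) \sum_(j in U) resolvent K i j ^+ 2) <= _).
  apply: ising_energy; last exact: sumsq_edge_matrix.
    have [G_sym _] := G_simple; apply/matrixP => i j.
    by rewrite !mxE G_sym.
  by move=> i j; rewrite !mxE mulr_ge0.
by rewrite ler_expR resolvent_block.
Qed.

End ResolventBlock.

(** * Overlap of randomly permuted vertex sets *)

Section PermutationOverlap.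
Variables (d : nat) (V : {set 'I_d}).
Implicit Types (J : {set 'I_d}) (p : {perm 'I_d}).

Let count J : nat := #|[set p : {perm 'I_d} | J \subset p @: V]%SET|.

(** Composing with the transposition of [i] and [k], which fixes [J], injects either family of
    permutations into the other. *)
Lemma count_tperm i k J : i \notin J -> k \notin J ->
  count (i |: J)%SET = count (k |: J)%SET.
Proof.
suff le (i' k' : 'I_d) : i' \notin J -> k' \notin J ->
    (count (i' |: J)%SET <= count (k' |: J)%SET)%N.
  by move=> iJ kJ; apply/eqP; rewrite eqn_leq !le.
move=> iJ kJ; rewrite /count -(card_imset _ (mulIg (tperm i' k'))).
apply: subset_leq_card; apply/fintype.subsetP => x /imsetP[p].
rewrite inE => /fintype.subsetP sub ->{x}.
rewrite inE; apply/fintype.subsetP => l lJ.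
have imE (q : 'I_d) :
    (q \in (p * tperm i' k')%g @: V)%SET = (tperm i' k' q \in p @: V)%SET.
  have -> : ((p * tperm i' k')%g @: V = tperm i' k' @: (p @: V))%SET.
    by rewrite -imset_comp; apply: eq_imset => v; rewrite permM.
  by rewrite -{1}(tpermK i' k' q) mem_imset //; exact: perm_inj.
rewrite imE sub //; move: lJ; rewrite !finset.in_setU1 => /predU1P[->|lJ].
  by rewrite tpermR eqxx.
by rewrite tpermD ?lJ ?orbT //; [apply: contraNneq iJ|apply: contraNneq kJ] => ->.
Qed.

(** Counting pairs of a permutation and a point [k] outside [J] with [k |: J] inside the image gives
    [(d - |J|) count (i |: J) = (|V| - |J|) count J]. As [|V| <= d], the ratio is at most [|V| / d]:
    inclusions are no likelier than under independent sampling. *)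
Lemma count_setU1 i J : i \notin J -> (d * count (i |: J)%SET <= #|V| * count J)%N.
Proof.
move=> iJ.
have Jd : (#|J| < d)%N.
  rewrite -[X in (_ < X)%N]card_ord.
  by apply: leq_trans (max_card (i |: J)%SET); rewrite cardsU1 iJ.
have sumE : ((d - #|J|) * count (i |: J)%SET = (#|V| - #|J|) * count J)%N.
  have -> : (d - #|J| = #|(~: J)%SET|)%N by rewrite [RHS]cardsCs finset.setCK card_ord.
  rewrite -sum_nat_const.
  rewrite (eq_bigr (fun k => \sum_(p : {perm 'I_d})
    (((k |: J) \subset p @: V)%SET : nat))) => [|k kJ]; last first.
    rewrite (@count_tperm i k) //; last by rewrite finset.in_setC in kJ.
    rewrite /count -sum1_card big_mkcond; apply: eq_bigr => p _.
    by rewrite inE; case: ifP.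
  rewrite exchange_big /= mulnC -sum_nat_const.
  rewrite [RHS]big_mkcond; apply: eq_bigr => p _; rewrite inE.
  case: ifPn => Jp; last first.
    by rewrite big1 // => k _; rewrite finset.subUset (negPf Jp) andbF.
  rewrite -[in RHS](card_imset V (@perm_inj _ p)) -cardsDS // -sum1_card.
  rewrite big_mkcond [RHS]big_mkcond; apply: eq_bigr => k _.
  rewrite finset.subUset Jp andbT finset.sub1set finset.in_setC finset.in_setD.
  by case: (k \in J); case: (k \in _).
have Vd : (#|V| <= d)%N by rewrite -[X in (_ <= X)%N]card_ord max_card.
have : (0 < d - #|J|)%N by rewrite subn_gt0.
move=> dJ; rewrite -(leq_pmul2l dJ) mulnCA sumE !mulnA leq_mul2r; apply/orP; right.
by rewrite mulnBr mulnBl leq_sub2l // (mulnC #|J|) leq_mul2r Vd orbT.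
Qed.

Lemma count_subset (R : realType) J : (0 < d)%N ->
  (count J)%:R <= d`!%:R * (#|V|%:R / d%:R) ^+ #|J| :> R.
Proof.
move=> d0; have [n] := ubnP #|J|; elim: n J => // n IHn J; rewrite ltnS => Jn.
have [->|[i iJ]] := set_0Vmem J.
  by rewrite cards0 expr0 mulr1 ler_nat -(card_Sn d) max_card.
pose J' := (J :\ i)%SET.
have JE : J = (i |: J')%SET by rewrite finset.setD1K.
have iJ' : i \notin J' by rewrite finset.setD11.
have cardJ : #|J| = #|J'|.+1 by rewrite (cardsD1 i) iJ.
have := count_setU1 iJ'; rewrite -JE -(ler_nat R) !natrM mulrC.
rewrite -ler_pdivlMr ?ltr0n // => /le_trans; apply.
rewrite cardJ in Jn; have := ler_wpM2r (_ : 0 <= #|V|%:R / d%:R) (IHn J' Jn).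
rewrite divr_ge0 // => /(_ isT) IH; rewrite cardJ exprS.
by lra.
Qed.

(* [y ^ |A n B| = prod_(i in B) (1 + (y - 1) [i in A])] reduces the exponential
   moment to the inclusion probabilities of subsets. *)
Lemma overlap_moment (R : realType) (B : {set 'I_d}) (y : R) :
  (0 < d)%N -> 1 <= y ->
  \sum_(p : {perm 'I_d}) y ^+ #|((p @: V) :&: B)%SET| <=
  d`!%:R * expR (#|B|%:R * ((y - 1) * (#|V|%:R / d%:R))).
Proof.
move=> d0 y1; pose c := y - 1; have c0 : 0 <= c by rewrite subr_ge0.
pose F (t : R) (A : {set 'I_d}) i := if (i \in A) && (i \in B) then t else 0 : R.
have expand (t : R) A : (1 + t) ^+ #|(A :&: B)%SET| =
    \sum_(J : {set 'I_d}) ((J \subset A) && (J \subset B))%:R * t ^+ #|J|.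
  transitivity (\prod_i (F t A i + 1)).
    rewrite -prodr_const big_mkcond; apply: eq_bigr => i _.
    by rewrite /F finset.in_setI; case: ifP; rewrite ?add0r // addrC.
  rewrite (bigA_distr _ _ (F t A) (fun=> 1)) /=; apply: eq_bigr => J _.
  rewrite -big_mkcond -finset.subsetI /=; case: (boolP (J \subset _)) => JAB.
    rewrite mul1r -prodr_const; apply: eq_bigr => i /(fintype.subsetP JAB).
    by rewrite /F finset.in_setI => ->.
  have /fintype.subsetPn[i iJ] := JAB; rewrite finset.in_setI => /negPf iAB.
  by rewrite mul0r (bigD1 i) //= /F iAB mul0r.
have -> : y = 1 + c by rewrite /c; lra.
under eq_bigr do rewrite expand.
rewrite exchange_big /=.
(* The inclusion in the full set is kept so that [expand] folds the sum back into
   [(1 + c |V| / d) ^+ #|B|]. *)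
apply: (@le_trans _ _ (\sum_(J : {set 'I_d})
    d`!%:R * ((J \subset [set: 'I_d]%SET) && (J \subset B))%:R *
    (c * (#|V|%:R / d%:R)) ^+ #|J|)).
  apply: ler_sum => J _; rewrite -mulr_suml finset.subsetT /=.
  have -> : \sum_(p : {perm 'I_d}) ((J \subset p @: V)%SET && (J \subset B))%:R =
      (count J)%:R * (J \subset B)%:R :> R.
    rewrite /count -sum1_card natr_sum mulr_suml [RHS]big_mkcond.
    apply: eq_bigr => p _; rewrite inE; case: (J \subset _) => //=.
    by rewrite mul1r.
  rewrite exprMn; have := ler_wpM2l (exprn_ge0 #|J| c0) (count_subset R J d0).
  by case: (J \subset B) => leJ; rewrite ?mulr0 ?mul0r ?mulr1 //; lra.
under eq_bigr do rewrite -mulrA.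
rewrite -mulr_sumr ler_wpM2l // -expand finset.setTI expRM_natl.
have q0 : 0 <= c * (#|V|%:R / d%:R) by rewrite mulr_ge0 // divr_ge0.
rewrite (_ : 1 + c - 1 = c); last by lra.
by rewrite lerXn2r ?nnegrE ?expR_ge0 ?expR_ge1Dx // addr_ge0.
Qed.

End PermutationOverlap.

(** * From second moments to the minimax risk *)

Section Testing.
Variable R : realType.

(** Le Cam's bound: the two errors add up to [1] minus the sum of [p - q] over the acceptance
    region. Cauchy-Schwarz bounds that sum by the root of the chi-square divergence of [q] from the
    uniform law. *)
Lemma uniform_testing (T : finType) (q : T -> R) (psi : pred T) :
  (0 < #|T|)%N -> \sum_x q x = 1 ->
  1 - Num.sqrt (#|T|%:R * (\sum_x q x ^+ 2) - 1) <=
  \sum_(x | psi x) #|T|%:R^-1 + \sum_(x | ~~ psi x) q x.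
Proof.
move=> T0 q1; pose N : R := #|T|%:R; pose p : R := N^-1.
have Np : N * p = 1 by rewrite mulfV // pnatr_eq0 -lt0n.
have p1 : \sum_(x : T) p = 1 by rewrite sumr_const -mulr_natl.
have chiE : N * (\sum_x q x ^+ 2) - 1 = N * \sum_x (p - q x) ^+ 2.
  rewrite [in RHS](eq_bigr (fun x => p * p - 2 * p * q x + q x ^+ 2)) => [|x _]; last by lra.
  rewrite big_split sumrB /= -!mulr_sumr q1 p1.
  move: (\sum_x _) => Q.
  rewrite (_ : N * (p * 1 - 2 * p * 1 + Q) = N * Q - N * p); last by lra.
  by rewrite Np.
have gap : \sum_(x | ~~ psi x) (p - q x) <= Num.sqrt (N * (\sum_x q x ^+ 2) - 1).
  apply: le_trans (ler_norm _) _; rewrite -sqrtr_sqr ler_wsqrtr // chiE.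
  have := cauchy_schwarz_sum (fun x => ~~ psi x) (fun=> 1 : R) (fun x => p - q x).
  rewrite (eq_bigr (fun x => p - q x)) => [/le_trans|x _]; last by rewrite mul1r.
  apply; apply: ler_pM.
  - by apply: sumr_ge0 => x _; exact: sqr_ge0.
  - by apply: sumr_ge0 => x _; exact: sqr_ge0.
  - rewrite big_mkcond /N -sum1_card natr_sum; apply: ler_sum => x _.
    by rewrite expr1n; case: ifP.
  - rewrite big_mkcond; apply: ler_sum => x _.
    by case: ifP => // _; rewrite sqr_ge0.
rewrite sumrB in gap; rewrite (bigID psi) /= in p1.
by rewrite -/N -/p; lra.
Qed.

End Testing.

Section IsingRisk.
Variables (R : realType) (d n : nat).
Implicit Types (S : set 'M[R]_d) (psi : sample d n -> bool) (Theta : 'M[R]_d).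

Definition sample_pmf Theta (X : sample d n) : R := \prod_(k < n) ising_pmf Theta (X k).

Lemma sample_pmf_ge0 Theta X : 0 <= sample_pmf Theta X.
Proof. by apply: prodr_ge0 => k _; exact: ising_pmf_ge0. Qed.

Lemma sum_sample_pmf Theta : \sum_X sample_pmf Theta X = 1.
Proof.
rewrite -(bigA_distr_bigA (fun (k : 'I_n) x => ising_pmf Theta x)) /=.
by rewrite big1 // => k _; exact: sum_ising_pmf.
Qed.

Lemma card_config : #|config d| = (2 ^ d)%N.
Proof. by rewrite card_ffun card_bool card_ord. Qed.

Lemma sample_pmf0 X : sample_pmf 0 X = #|sample d n|%:R^-1.
Proof.
have pmf0 x : ising_pmf (0 : 'M[R]_d) x = (2 ^ d)%:R^-1.
  have w0 z : ising_weight (0 : 'M[R]_d) z = 1.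
    rewrite /ising_weight big1 ?expR0 // => i _; rewrite big1 // => j _.
    by rewrite mxE !mul0r.
  rewrite /ising_pmf w0 mul1r; congr (_^-1).
  by rewrite /partition_function (eq_bigr _ (fun z _ => w0 z)) sumr_const card_config.
rewrite /sample_pmf (eq_bigr _ (fun k _ => pmf0 _)) prodr_const.
by rewrite !card_ord card_ffun card_config card_ord [in RHS]natrX exprVn.
Qed.

Lemma ising_prob_le1 Theta (A : pred (sample d n)) : ising_prob Theta A <= 1.
Proof.
rewrite -(sum_sample_pmf Theta) /ising_prob big_mkcond; apply: ler_sum => X _.
by case: ifP => // _; exact: sample_pmf_ge0.
Qed.

Lemma ising_prob_ge0 Theta (A : pred (sample d n)) : 0 <= ising_prob Theta A.
Proof. by apply: sumr_ge0 => X _; exact: sample_pmf_ge0. Qed.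

(** The worst type II error over [S] dominates the average over the [Theta i], which is the error
    under their mixture [q]. Independence of the samples turns the second moment of [q] into [n]-th
    powers of one-sample moments. *)
Lemma test_risk_ge S psi (I : finType) (Theta : I -> 'M[R]_d) :
  (0 < #|I|)%N -> (forall i, S (Theta i)) ->
  1 - Num.sqrt (#|I|%:R ^- 2 * (\sum_i \sum_j
    (2 ^+ d * \sum_x ising_pmf (Theta i) x * ising_pmf (Theta j) x) ^+ n) - 1) <=
  test_risk S psi.
Proof.
move=> I0 STheta; pose c : R := #|I|%:R^-1.
have cI : c * #|I|%:R = 1 by rewrite mulVf // pnatr_eq0 -lt0n.
pose q X : R := c * \sum_i sample_pmf (Theta i) X.
have q1 : \sum_X q X = 1.
  rewrite -mulr_sumr exchange_big (eq_bigr (fun=> 1)) => [|i _]; last exact: sum_sample_pmf.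
  by rewrite sumr_const -[_ *+ _]mulr_natr mul1r.
have T0 : (0 < #|sample d n|)%N by rewrite card_ffun card_config expn_gt0 expn_gt0.
have chiE : #|I|%:R ^- 2 * (\sum_i \sum_j
    (2 ^+ d * \sum_x ising_pmf (Theta i) x * ising_pmf (Theta j) x) ^+ n) =
    #|sample d n|%:R * \sum_X q X ^+ 2.
  rewrite (eq_bigr (fun X => c ^+ 2 * \sum_i \sum_j
    sample_pmf (Theta i) X * sample_pmf (Theta j) X)) => [|X _]; last first.
    by rewrite /q exprMn [X in _ * X]expr2 big_distrlr.
  rewrite -mulr_sumr mulrCA -exprVn; congr (_ * _).
  rewrite [in RHS]exchange_big mulr_sumr; apply: eq_bigr => i _.
  rewrite [in RHS]exchange_big mulr_sumr; apply: eq_bigr => j _.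
  rewrite exprMn card_ffun card_config card_ord !natrX; congr (_ * _).
  rewrite [RHS](eq_bigr (fun X : sample d n => \prod_(k < n) (ising_pmf (Theta i) (X k) *
      ising_pmf (Theta j) (X k)))) => [|X _]; last by rewrite -big_split.
  rewrite -(bigA_distr_bigA (fun (k : 'I_n) x =>
    ising_pmf (Theta i) x * ising_pmf (Theta j) x)) /=.
  by rewrite prodr_const card_ord.
rewrite chiE; apply: le_trans (uniform_testing psi T0 q1) _.
rewrite /test_risk; apply: lerD.
  rewrite le_eqVlt; apply/orP; left; apply/eqP; apply: eq_bigr => X _.
  exact: esym (sample_pmf0 X).
rewrite -mulr_sumr exchange_big /=.
set s := sup _; have le_s i : ising_prob (Theta i) (predC psi) <= s.
  apply: ub_le_sup; last by exists (Theta i).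
  by exists 1 => _ [Th' _ <-]; exact: ising_prob_le1.
apply: (@le_trans _ _ (c * \sum_(i : I) s)).
  by rewrite ler_wpM2l ?invr_ge0 //; apply: ler_sum => i _; exact: le_s.
by rewrite sumr_const -[s *+ _]mulr_natl mulrA cI mul1r.
Qed.

Lemma minimax_risk_ge S (I : finType) (Theta : I -> 'M[R]_d) (chi : R) :
  (0 < #|I|)%N -> (forall i, S (Theta i)) ->
  #|I|%:R ^- 2 * (\sum_i \sum_j
    (2 ^+ d * \sum_x ising_pmf (Theta i) x * ising_pmf (Theta j) x) ^+ n) <= chi ->
  1 - Num.sqrt (chi - 1) <= minimax_risk n S.
Proof.
move=> I0 STheta lechi; apply: lb_le_inf.
  by exists (test_risk S (fun _ : sample d n => true)); exists (fun=> true).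
move=> _ [psi _ <-]; apply: le_trans (test_risk_ge psi I0 STheta).
by rewrite lerD2l lerN2 ler_wsqrtr // lerD2r.
Qed.

(** The test that always rejects makes no type II error. For an empty class, the supremum takes its
    default value 0. *)
Lemma minimax_risk_le1 S : minimax_risk n S <= 1.
Proof.
pose psi := fun _ : sample d n => true.
have sup_ge0 (psi' : sample d n -> bool) :
    0 <= sup [set ising_prob Theta (predC psi') | Theta in S].
  have [[Th STh]|S0] := pselect (exists Theta, S Theta).
    apply: le_trans (ising_prob_ge0 Th (predC psi')) _.
    apply: ub_le_sup; last by exists Th.
    by exists 1 => _ [Th' _ <-]; exact: ising_prob_le1.
  rewrite (_ : [set _ | _ in _] = set0) ?sup0 //.
  by apply/seteqP; split => // x [Th STh _]; apply: S0; exists Th.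
apply: (@le_trans _ _ (test_risk S psi)).
  apply: ge_inf; last by exists psi.
  by exists 0 => _ [psi' _ <-]; rewrite addr_ge0 ?ising_prob_ge0.
rewrite /test_risk -[leRHS]addr0 lerD ?ising_prob_le1 //.
have prob0 Theta : ising_prob Theta (predC psi) = 0 by rewrite /ising_prob big_pred0.
have [[Th STh]|S0] := pselect (exists Theta, S Theta).
  apply: ge_sup; first by exists (ising_prob Th (predC psi)); exists Th.
  by move=> _ [Th' _ <-]; rewrite prob0.
rewrite (_ : [set _ | _ in _] = set0) ?sup0 //.
by apply/seteqP; split => // x [Th STh _]; apply: S0; exists Th.
Qed.

End IsingRisk.

(** * The risk bound at a fixed sample size *)

Section FixedSampleSize.
Variables (R : realType) (d n : nat) (G : rel 'I_d) (theta : R).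
Hypotheses (G_simple : simple_graph G) (G_nonempty : nonempty_graph G).
Hypothesis theta_gt0 : 0 < theta.

Let F : R := frobenius_norm (adjacency R G).
Let r : R := (arboricity R G)%:~R.
Let s : nat := #|non_isolated G|.
Let f2 : R := \sum_i \sum_j (G i j)%:R.
Let L : R := ln (d%:R / s%:R ^+ 2).

Hypothesis theta_le : theta <=
  Num.min (Num.min (Num.sqrt (L / (6 * n%:R * r))) (Num.sqrt (r / calB R G)))
    (1 / (8 * Num.max F (op_norm1 (adjacency R G)))).

(** Positivity of [t] excludes the default value 0 of a quotient by 0 and of the root of a negative
    number. *)
Lemma sqr_mul_le_of_le_sqrt_div (t x y : R) :
  0 < t -> 0 <= y -> t <= Num.sqrt (x / y) -> t ^+ 2 * y <= x.
Proof.
move=> t0 y0 tle; have x0 : 0 < x / y by rewrite -sqrtr_gt0 (lt_le_trans t0).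
have y_gt0 : 0 < y.
  by rewrite lt_def y0 andbT; apply: contraTneq x0 => ->; rewrite invr0 mulr0 ltxx.
rewrite -ler_pdivlMr // -(sqr_sqrtr (ltW x0)) lerXn2r // nnegrE; first exact: ltW.
exact: sqrtr_ge0.
Qed.

Let F_ge0 : 0 <= F. Proof. exact: sqrtr_ge0. Qed.

Let f2E : F ^+ 2 = f2. Proof. exact: frobenius_adjacency. Qed.

Let r_ge0 : 0 <= r. Proof. by rewrite ler0z arboricity_ge0. Qed.

Lemma theta_sample_size : theta ^+ 2 * (6 * n%:R * r) <= L.
Proof.
apply: sqr_mul_le_of_le_sqrt_div => //; first by rewrite !mulr_ge0.
by move: theta_le; rewrite !le_min => /andP[/andP[]].
Qed.

(** Replacing the maximum in [calB] by [F] only lowers it, and [F ^+ 2 = f2]. *)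
Lemma theta_calB : theta ^+ 2 * (512 * (f2 * Num.min f2 s%:R)) <= r.
Proof.
apply: (@le_trans _ _ (theta ^+ 2 * calB R G)); last first.
  apply: sqr_mul_le_of_le_sqrt_div => //.
    by rewrite /calB mulr_ge0 // le_min !mulr_ge0 ?exprn_ge0 // le_max F_ge0 orbT.
  by move: theta_le; rewrite !le_min => /andP[/andP[]].
have F_max : F <= Num.max (op_norm1 (adjacency R G)) F by rewrite le_max lexx orbT.
rewrite ler_wpM2l ?sqr_ge0 // /calB ler_wpM2l // -/F -/s -f2E.
rewrite le_min; apply/andP; split.
  rewrite (_ : F ^+ 4 = F ^+ 2 * F ^+ 2); last by rewrite -exprD.
  by rewrite ler_wpM2l ?sqr_ge0 // ge_min lexx.
apply: ler_pM; rewrite ?sqr_ge0 //.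
- by rewrite le_min sqr_ge0 ler0n.
- by rewrite lerXn2r // nnegrE (le_trans F_ge0).
- by rewrite ge_min lexx orbT.
Qed.

Lemma theta_norm : 64 * theta ^+ 2 * f2 <= 1.
Proof.
set M := Num.max F (op_norm1 (adjacency R G)).
have FM : F <= M by rewrite le_max lexx.
have thetaM : theta <= 1 / (8 * M) by move: theta_le; rewrite le_min => /andP[].
(* If [M] were 0, the upper bound on [theta] would be [1 / 0 = 0]. *)
have M0 : 0 < M.
  rewrite lt_def (le_trans F_ge0) // andbT; apply: contraTneq thetaM => ->.
  by rewrite mulr0 invr0 mulr0 -ltNge.
have le1 : 8 * theta * F <= 1.
  rewrite ler_pdivlMr ?mulr_gt0 // in thetaM.
  apply: le_trans thetaM; rewrite -mulrA mulrCA ler_wpM2l ?(ltW theta_gt0) //.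
  by rewrite ler_wpM2l.
rewrite -f2E (_ : 64 * theta ^+ 2 * F ^+ 2 = (8 * theta * F) ^+ 2); last by lra.
by rewrite exprn_ile1 // !mulr_ge0 // ltW.
Qed.

Let Theta (p : {perm 'I_d}) : 'M[R]_d := theta *: adjacency R (perm_graph p G).

Let Theta_ge0 p i j : 0 <= Theta p i j.
Proof. by rewrite !mxE mulr_ge0 // ltW. Qed.

Let Theta_sym p : (Theta p)^T = Theta p.
Proof.
have [G_sym _] := perm_graph_simple p G_simple.
by apply/matrixP => i j; rewrite !mxE G_sym.
Qed.

Lemma perm_signal p : signal_class (containing G) theta (Theta p).
Proof.
have [G_sym G_irr] := perm_graph_simple p G_simple.
have supportE : support_graph (Theta p) = perm_graph p G.
  apply/funext => i; apply/funext => j; rewrite /support_graph !mxE.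
  by case: (perm_graph p G i j); rewrite ?mulr1 ?mulr0 ?eqxx ?gt_eqF.
split.
- exact: Theta_sym.
- by move=> i; rewrite !mxE G_irr mulr0.
- rewrite supportE; split; first exact: perm_graph_simple.
  exists (perm_graph p G); split; last exact: perm_graph_isomorphic.
  by split; first exact: perm_graph_simple.
- rewrite -(@ger0_norm _ (1 / 2)) // -sqrtr_sqr ler_wsqrtr //.
  have -> : \sum_i \sum_j Theta p i j ^+ 2 = theta ^+ 2 * f2.
    rewrite /f2 -(double_sumT_perm R p) mulr_sumr; apply: eq_bigr => i _.
    rewrite mulr_sumr; apply: eq_bigr => j _; rewrite !mxE exprMn.
    by case: (perm_graph p G i j); rewrite ?expr1n ?expr0n.
  by have := theta_norm => ?; lra.
- by move=> i j; rewrite supportE !mxE => ->; rewrite mulr1.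
Qed.

(** The hypotheses of [graph_energy_le] are invariant under relabelling, so the bounds for [G] serve
    every copy. *)
Lemma perm_energy p (U : {set 'I_d}) :
  energy (ising_corr (Theta p)) U <= expR (11 / 2 * theta ^+ 2 * r * #|U|%:R).
Proof.
apply: graph_energy_le.
- exact: perm_graph_simple.
- exact: ltW.
- by rewrite double_sumT_perm theta_norm.
- rewrite double_sumT_perm non_isolated_perm card_imset; last exact: perm_inj.
  exact: theta_calB.
- move=> V; rewrite double_sum_perm -(card_preim_perm p V).
  exact: double_sum_le_arboricity.
Qed.

Lemma minimax_risk_lower :
  1 - Num.sqrt (expR (expR (- (L / 12))) - 1) <=
  minimax_risk n (signal_class (containing G) theta).
Proof.
have [i0 [j0 Gij]] := G_nonempty.
have d0 : (0 < d)%N by apply: leq_ltn_trans (ltn_ord i0).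
have s0 : (0 < s)%N.
  by rewrite card_gt0; apply/finset.set0Pn; exists i0; rewrite inE; apply/existsP; exists j0.
(* The cost of one common vertex over all [n] samples. *)
pose y := expR (11 / 2 * theta ^+ 2 * r * n%:R).
have y1 : 1 <= y.
  by rewrite -expR0 ler_expR !mulr_ge0 ?(ltW theta_gt0).
pose V p := non_isolated (perm_graph p G).
have VE p : V p = (p @: non_isolated G)%SET by exact: non_isolated_perm.
have cardV p : #|V p| = s by rewrite VE card_imset //; exact: perm_inj.
have V0 p i j : i \notin V p -> Theta p i j = 0.
  rewrite !mxE inE negb_exists => /forallP/(_ j)/negPf ->.
  by rewrite mulr0.
apply: (minimax_risk_ge (I := {perm 'I_d}) (Theta := Theta)).
- by apply/card_gt0P; exists 1%g.
- exact: perm_signal.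
have pair_le p q : (2 ^+ d * \sum_x ising_pmf (Theta p) x * ising_pmf (Theta q) x) ^+ n <=
    y ^+ #|((p @: non_isolated G) :&: V q)%SET|.
  apply: (@le_trans _ _ (expR (11 / 2 * theta ^+ 2 * r * #|(V p :&: V q)%SET|%:R) ^+ n)).
    rewrite lerXn2r ?nnegrE ?expR_ge0 //.
      by rewrite mulr_ge0 ?exprn_ge0 // sumr_ge0 // => x _; rewrite mulr_ge0 ?ising_pmf_ge0.
    apply: le_trans (ising_second_moment (Theta_sym p) (Theta_ge0 p) (Theta_sym q)
      (Theta_ge0 q) (V0 p) (V0 q)) _.
    by have := perm_energy p (V p :&: V q); have := perm_energy q (V p :&: V q) => *; lra.
  rewrite -VE -!expRM_natl ler_expR le_eqVlt; apply/orP; left; apply/eqP; lra.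
have dfact0 : 0 < d`!%:R :> R by rewrite ltr0n fact_gt0.
rewrite card_Sn; apply: (@le_trans _ _ (expR (s%:R * ((y - 1) * (s%:R / d%:R))))).
  rewrite mulrC ler_pdivrMr ?exprn_gt0 // exchange_big /=.
  apply: (@le_trans _ _ (\sum_(q : {perm 'I_d})
      d`!%:R * expR (s%:R * ((y - 1) * (s%:R / d%:R))))).
    (* For each fixed [q], the average over [p] is an overlap moment with a fixed set of [s]
       vertices. *)
    apply: ler_sum => q _.
    apply: le_trans (_ : \sum_(p : {perm 'I_d})
      y ^+ #|((p @: non_isolated G) :&: V q)%SET| <= _).
      by apply: ler_sum => p _; exact: pair_le.
    by have := overlap_moment (non_isolated G) (V q) d0 y1; rewrite cardV.
  by rewrite sumr_const card_Sn -[_ *+ _]mulr_natl; lra.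
rewrite ler_expR.
have ratio0 : 0 < d%:R / s%:R ^+ 2 :> R by rewrite divr_gt0 ?exprn_gt0 ?ltr0n.
have expL : expR (- L) = s%:R ^+ 2 / d%:R :> R.
  by rewrite expRN lnK ?posrE // invf_div.
(* Since [s^2 / d = expR (- L)] and [y <= expR (11/12 L)], the exponent is at most
   [expR (- L / 12)]. *)
apply: (@le_trans _ _ (y * expR (- L))).
  rewrite expL (_ : s%:R * _ = (y - 1) * (s%:R ^+ 2 / d%:R)); last by lra.
  by rewrite ler_wpM2r ?divr_ge0 ?exprn_ge0 //; lra.
by rewrite /y -expRD ler_expR; have := theta_sample_size => ?; lra.
Qed.

End FixedSampleSize.

(** * Passage to the limit *)

Theorem corollary2p6 (R : realType) (d s : nat -> nat)
    (Gs : forall n, rel 'I_(d n)) (theta : nat -> R)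
    (simple_Gs : forall n, simple_graph (Gs n))
    (nonempty_Gs : forall n, nonempty_graph (Gs n))
    (card_s : forall n, #|non_isolated (Gs n)| = s n)
    (s_small : (fun n => (s n)%:R : R^o) =o_\oo
               (fun n => Num.sqrt (d n)%:R : R^o))
    (theta_gt0 : forall n, 0 < theta n)
    (theta_le : \forall n \near \oo,
      let AF := frobenius_norm (adjacency R (Gs n)) in
      let A1 := op_norm1 (adjacency R (Gs n)) in
      let arb : R := (arboricity R (Gs n))%:~R in
      theta n <=
        Num.min
          (Num.min
            (Num.sqrt (ln ((d n)%:R / (s n)%:R ^+ 2) / (6 * n%:R * arb)))
            (Num.sqrt (arb / calB R (Gs n))))
          (1 / (8 * Num.max AF A1))) :
  limn_inf (fun n =>
    minimax_risk n (signal_class (containing (Gs n)) (theta n))) = 1.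
Proof.
(* The risk in fact converges to 1, which determines its limit inferior. *)
apply: (cvg_limn_inf_sup _).1; apply/cvgrPdist_le => e e0.
(* Chosen so that [Num.sqrt (expR delta - 1) = e]. *)
pose delta := ln (1 + e ^+ 2).
have delta0 : 0 < delta by rewrite ln_gt0 // ltrDl exprn_gt0.
(* Then [expR (- L) = s^2 / d <= delta^12], and its twelfth root, which enters the lower bound, is
   at most [delta]. *)
have /eqoP/(_ (delta ^+ 6)) small := s_small.
near=> n.
rewrite ler_norml; apply/andP; split.
  have := minimax_risk_le1 n (signal_class (containing (Gs n)) (theta n)) => ?; lra.
have sn : `|(s n)%:R : R| <= delta ^+ 6 * `|Num.sqrt (d n)%:R : R|.
  by near: n; apply: small; rewrite exprn_gt0.
have thetan : theta n <= Num.min (Num.min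
    (Num.sqrt (ln ((d n)%:R / (s n)%:R ^+ 2) /
      (6 * n%:R * (arboricity R (Gs n))%:~R)))
    (Num.sqrt ((arboricity R (Gs n))%:~R / calB R (Gs n))))
    (1 / (8 * Num.max (frobenius_norm (adjacency R (Gs n)))
      (op_norm1 (adjacency R (Gs n))))) by near: n.
rewrite -card_s in thetan.
have := minimax_risk_lower (simple_Gs n) (nonempty_Gs n) (theta_gt0 n) thetan.
rewrite card_s; set L := ln _ => lower.
suff : Num.sqrt (expR (expR (- (L / 12))) - 1) <= e by move=> ?; lra.
have [i0 [j0 Gij]] := nonempty_Gs n.
have d0 : 0 < (d n)%:R :> R by rewrite ltr0n; apply: leq_ltn_trans (ltn_ord i0).
have s0 : 0 < (s n)%:R :> R.
  rewrite ltr0n -card_s card_gt0; apply/finset.set0Pn; exists i0.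
  by rewrite inE; apply/existsP; exists j0.
have expL : expR (- L) <= delta ^+ 12.
  rewrite expRN lnK ?posrE ?divr_gt0 ?exprn_gt0 // invf_div ler_pdivrMr //.
  rewrite !ger0_norm ?sqrtr_ge0 // in sn.
  rewrite -[X in _ * X](sqr_sqrtr (ltW d0)) -[12%N]/(6 * 2)%N exprM -exprMn.
  by rewrite lerXn2r // nnegrE ?mulr_ge0 ?exprn_ge0 ?sqrtr_ge0 // ltW.
have expL12 : expR (- (L / 12)) <= delta.
  rewrite -(@ler_pXn2r _ 12) ?nnegrE ?expR_ge0 ?(ltW delta0) //.
  by rewrite -expRM_natl (_ : _ * _ = - L) //; lra.
rewrite -[leRHS]ger0_norm ?(ltW e0) // -sqrtr_sqr ler_wsqrtr //.
rewrite lerBlDl -[leRHS]lnK ?posrE ?ler_expR //.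
by rewrite ltr_wpDr ?sqr_ge0.
Unshelve. all: by end_near.
Qed.
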